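(* Let $N\in\mathcal{LC}$. Then the set of sequences $M\in\mathcal{N}_{\preceq,R}$ resp. $M\in\mathcal{N}_{\preceq,B}$ satisfying $$\mathcal{B}(\mathcal{D}_{\{N\}}([-1,1]))\supseteq\Lambda_{\{M\}},\quad\text{resp.}\quad\mathcal{B}(\mathcal{D}_{(N)}([-1,1]))\supseteq\Lambda_{(M)},$$ has a maximal element, which is given by some/each $L^s$, $s\in\mathbb{N}_{>0}$. Alternatively, one can use $\widetilde{(L^s)^{\mathrm{lc}}}$, which is $\preceq$-maximal among all $M\in\mathcal{N}_{\preceq,\mathcal{LC},R}$ resp. $M\in\mathcal{N}_{\preceq,\mathcal{LC},B}$ satisfying the respective inclusion above.
   Context: $\mathbb{N}=\{0,1,2,\dots\}$, $\mathbb{N}_{>0}=\{1,2,\dots\}$. $\mathcal{LC}$ is the set of sequences $N\in\mathbb{R}_{>0}^{\mathbb{N}}$ that are normalized ($1=N_0\le N_1$), log-convex ($N_j^2\le N_{j-1}N_{j+1}$ for $j\ge1$) and satisfy $\lim_{j\to+\infty}(N_j)^{1/j}=+\infty$. Put $\nu_j:=N_j/N_{j-1}$ for $j\ge1$ and $\nu_0:=1$. $M\preceq N$ means $\sup_{j\ge1}(M_j/N_j)^{1/j}<+\infty$; $M$ and $N$ are equivalent if $M\preceq N$ and $N\preceq M$. Maximality is understood with respect to the relation $\preceq$. For the fixed $N$: $\mathcal{N}_{\preceq,R}:=\{M\in\mathbb{R}_{>0}^{\mathbb{N}}:\liminf_{p\to+\infty}(M_p/p!)^{1/p}>0,\ M\preceq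 N\}$, $\mathcal{N}_{\preceq,B}:=\{M\in\mathbb{R}_{>0}^{\mathbb{N}}:\lim_{p\to+\infty}(M_p/p!)^{1/p}=+\infty,\ M\preceq N\}$, $\mathcal{N}_{\preceq,\mathcal{LC},R}:=\mathcal{N}_{\preceq,R}\cap\mathcal{LC}$, $\mathcal{N}_{\preceq,\mathcal{LC},B}:=\mathcal{N}_{\preceq,B}\cap\mathcal{LC}$. For $s\in\mathbb{N}_{>0}$ the sequence $L^s=(L^s_p)_{p\in\mathbb{N}}$ is given by $L^s_0:=1$ and $L^s_p:=s^p\min_{0\le j\le p-1}\left\{\left(\frac{p}{\sum_{k\ge p}1/\nu_k}\right)^{p-j}N_j\right\}$ for $p\in\mathbb{N}_{>0}$. For a sequence $M$, $M^{\mathrm{lc}}$ denotes its log-convex minorant, i.e. the largest log-convex sequence $K$ with $K_j\le M_j$ for all $j$. $\widetilde{(L^s)^{\mathrm{lc}}}$ denotes a sequence in $\mathcal{N}_{\preceq,\mathcal{LC},B}$ equivalent to $(L^s)^{\mathrm{lc}}$ (passing to an equivalent sequence because normalization might fail for $(L^s)^{\mathrm{lc}}$). For $M\in\mathbb{R}_{>0}^{\mathbb{N}}$ and $h>0$: $\Lambda_{M,h}:=\{(a_p)_p\in\mathbb{C}^{\mathbb{N}}:\sup_{p\in\mathbb{N}} |a_p|/(h^pM_p)<+\infty\}$, $\Lambda_{\{M\}}:=\bigcup_{h>0}\Lambda_{M,h}$ (Roumieu-type), $\Lambda_{(M)}:=\bigcap_{h>0}\Lambda_{M,h}$ (Beurling-type).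 $\mathcal{D}_{M,h}([-1,1])$ is the space of $f\in C^\infty(\mathbb{R},\mathbb{C})$ with $\operatorname{supp} f\subseteq[-1,1]$ and $\sup_{p\in\mathbb{N},x\in\mathbb{R}}|f^{(p)}(x)|/(h^pM_p)<+\infty$; $\mathcal{D}_{\{M\}}([-1,1]):=\bigcup_{h>0}\mathcal{D}_{M,h}([-1,1])$ and $\mathcal{D}_{(M)}([-1,1]):=\bigcap_{h>0}\mathcal{D}_{M,h}([-1,1])$. The Borel map is $\mathcal{B}(f):=(f^{(p)}(0))_{p\in\mathbb{N}}$. The first alternative before each ''resp.'' is the Roumieu case, the second the Beurling case.
   Formalization: The formal theorem additionally assumes that the sum of 1/ν_k over k≥1 converges; otherwise (e.g. N_j = j!) L^s is not a positive sequence and, by Denjoy–Carleman, no M satisfies the inclusion, so no maximal element exists. *)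

(* Defs.v *)
From Stdlib Require Import Reals RList Arith.Factorial List.
From Coquelicot Require Import Coquelicot.
Open Scope R_scope.

Definition positive_seq (M : nat -> R) : Prop := forall p, 0 < M p.

Definition log_convex (M : nat -> R) : Prop :=
  forall j, (1 <= j)%nat -> M j ^ 2 <= M (j - 1)%nat * M (j + 1)%nat.

(* The [p]-th root of a positive number.  [Rpower] is only meaningful on
   positive arguments, and the value at [p = 0] is junk; it is never relevant,
   since roots occur only for [p >= 1] or inside a limit. *)
Definition root (p : nat) (x : R) : R := Rpower x (/ INR p).

Definition LC (M : nat -> R) : Prop :=
  positive_seq M /\ M 0%nat = 1 /\ 1 <= M 1%nat /\ log_convex M /\
  is_lim_seq (fun j => root j (M j)) p_infty.

Definition nu (M : nat -> R) (j : nat) : R :=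
  match j with O => 1 | S i => M (S i) / M i end.

Definition nonquasianalytic (M : nat -> R) : Prop :=
  ex_series (fun k => / nu M (S k)).

Definition preceq (M N : nat -> R) : Prop :=
  exists B : R, forall j, (1 <= j)%nat -> root j (M j / N j) <= B.

Definition equiv_seq (M N : nat -> R) : Prop := preceq M N /\ preceq N M.

(* [preceq] is a preorder, so a maximal element is determined at most up to
   [equiv_seq].  This is maximality in its strong form, [m] dominating the whole
   of [S]; the order-theoretic form follows, see [maximal_weak]. *)
Definition maximal (S : (nat -> R) -> Prop) (m : nat -> R) : Prop :=
  S m /\ forall M, S M -> preceq M m.

Lemma maximal_weak (S : (nat -> R) -> Prop) (m : nat -> R) :
  maximal S m -> S m /\ forall M, S M -> preceq m M -> preceq M m.
Proof.
  intros [Sm H]; split; [exact Sm|].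
  intros M SM _; exact (H M SM).
Qed.

Definition N_R (N M : nat -> R) : Prop :=
  positive_seq M /\
  Rbar_lt 0 (LimInf_seq (fun p => root p (M p / INR (fact p)))) /\
  preceq M N.

Definition N_B (N M : nat -> R) : Prop :=
  positive_seq M /\
  is_lim_seq (fun p => root p (M p / INR (fact p))) p_infty /\
  preceq M N.

Definition N_LC_R (N M : nat -> R) : Prop := N_R N M /\ LC M.

Definition N_LC_B (N M : nat -> R) : Prop := N_B N M /\ LC M.

(* [Series] returns a junk value on divergent series: [tail_sum N p] is the
   intended sum only when [N] is non-quasianalytic. *)
Definition tail_sum (N : nat -> R) (p : nat) : R :=
  Series (fun k => / nu N (p + k)).

Definition Lseq (N : nat -> R) (s p : nat) : R :=
  match p with
  | O => 1
  | S _ => INR s ^ p *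
      MinRlist (map (fun j => (INR p / tail_sum N p) ^ (p - j) * N j) (seq 0 p))
  end.

Definition is_lc_minorant (M K : nat -> R) : Prop :=
  (positive_seq K /\ log_convex K /\ forall j, K j <= M j) /\
  forall K', positive_seq K' -> log_convex K' -> (forall j, K' j <= M j) ->
    forall j, K' j <= K j.

Definition is_Lseq_lc_tilde (N : nat -> R) (s : nat) (T : nat -> R) : Prop :=
  N_LC_B N T /\
  exists K, is_lc_minorant (Lseq N s) K /\ equiv_seq T K.

Definition Lambda_h (M : nat -> R) (h : R) (a : nat -> C) : Prop :=
  exists B : R, forall p, Cmod (a p) / (h ^ p * M p) <= B.

Definition Lambda_R (M : nat -> R) (a : nat -> C) : Prop :=
  exists h, 0 < h /\ Lambda_h M h a.

Definition Lambda_B (M : nat -> R) (a : nat -> C) : Prop :=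
  forall h, 0 < h -> Lambda_h M h a.

Definition CDerive_n (f : R -> C) (n : nat) (x : R) : C :=
  (Derive_n (fun t => Re (f t)) n x, Derive_n (fun t => Im (f t)) n x).

Definition smooth (f : R -> C) : Prop :=
  forall n x, ex_derive_n (fun t => Re (f t)) n x /\
              ex_derive_n (fun t => Im (f t)) n x.

Definition supp (f : R -> C) : R -> Prop :=
  adherence (fun x => f x <> RtoC 0).

Definition D_h (M : nat -> R) (h : R) (f : R -> C) : Prop :=
  smooth f /\ included (supp f) (fun x => -1 <= x <= 1) /\
  exists B : R, forall p x, Cmod (CDerive_n f p x) / (h ^ p * M p) <= B.

Definition D_R (M : nat -> R) (f : R -> C) : Prop :=
  exists h, 0 < h /\ D_h M h f.

Definition D_B (M : nat -> R) (f : R -> C) : Prop :=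
  forall h, 0 < h -> D_h M h f.

Definition Borel (f : R -> C) (p : nat) : C := CDerive_n f p 0.

Definition Borel_image_R (N M : nat -> R) : Prop :=
  forall a, Lambda_R M a -> exists f, D_R N f /\ forall p, Borel f p = a p.

Definition Borel_image_B (N M : nat -> R) : Prop :=
  forall a, Lambda_B M a -> exists f, D_B N f /\ forall p, Borel f p = a p.

(* Main.v *)
Require Import Defs.
From Stdlib Require Import Reals Lra Lia RList List Arith Classical ClassicalEpsilon.
From Coquelicot Require Import Coquelicot.
Open Scope R_scope.

(** The sequence [Lseq N s] is exactly the obstruction to interpolation: the
    Borel map reaches every sequence controlled by it, and any sequence [M]
    whose class is reached satisfies [M p <= B ^ p * Lseq N s p]. Write [sigma_p] for
    the tail sum of the [1 / nu_k], [k >= p].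

    Reaching the class. For each [p] there is a function with the jet of
    [x ^ p / p!] at [0], supported in an interval of length about
    [eps * sigma_p]. It is a cut-off times a monomial; the cut-off is an infinite
    convolution of box functions, [p] of them of width about [eps * sigma_p / p]
    and one of width [eps / nu_k] for each [k > p]. Its [j]-th derivative is of size
    [eps ^ (p - j) * (sigma_p / p) ^ (p - j)] for [j <= p], which against a coefficient
    of size [Lseq N s p] leaves at most [N j]. This is why the minimum of
    [(p / sigma_p) ^ (p - j) * N j] appears. A small [eps] makes the series
    converge ([localized_monomial], [borel_series]). In the Beurling case the data
    decay faster than [Lseq N s] by a factor whose root tends to infinity, and
    part of it can be used to divide the weight by slowly growing factors
    without spoiling its tail sums ([Borel_image_B_Lseq]).

    Maximality. Suppose that [M] is not dominated. Then there are very sparse indices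
    [p] where [M] exceeds [Lseq N s] by a large factor. Take nonnegative data
    carried by these indices and a function [F] that interpolates them. Subtract from [F]
    its Taylor polynomial [P] of degree [p]; the difference is flat at [0] up to
    the next index. By Bang's argument a function flat at [0] with derivatives
    controlled by [N] stays small, compared to these bounds, on an interval of
    length proportional to [sigma_p] ([flat_propagation]). Hence [P] and its
    derivatives satisfy on this interval the same bounds as those of [F]
    ([taylor_poly_bound]). Its coefficients are nonnegative, so the leading term
    alone satisfies them, and evaluation at distance [sigma_p] from [0] gives
    [M p <= B ^ p * (p / sigma_p) ^ (p - j) * N j] for every [j < p], up to the
    decay put into the data: a contradiction. This argument treats both cases at once
    ([preceq_Lseq_of_interpolation]).

    The log-convex minorant of [Lseq N s] dominates every log-convex sequence
    dominated by [Lseq N s], so maximality passes to it. *)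

(** * Derivative towers *)

(** A smooth function is carried together with all its derivatives: the
    constructions below give explicit formulas for every derivative, whereas
    [Derive_n] of a sum, product or limit would have to be computed each time. *)
Definition tower (F : nat -> R -> R) : Prop :=
  forall n x, is_derive (F n) x (F (S n) x).

Lemma tower_Derive_n (F : nat -> R -> R) :
  tower F -> forall n x, Derive_n (F 0%nat) n x = F n x.
Proof.
  intros HF n; induction n as [|n IH]; intros x; simpl; [reflexivity|].
  rewrite (Derive_ext _ (F n) x IH).
  apply is_derive_unique, HF.
Qed.

Lemma tower_ex_derive_n (F : nat -> R -> R) :
  tower F -> forall n x, ex_derive_n (F 0%nat) n x.
Proof.
  intros HF [|n] x; simpl; [exact I|].
  exists (F (S n) x).
  apply (is_derive_ext (F n)); [|apply HF].
  intros t; symmetry; apply tower_Derive_n, HF.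
Qed.

Lemma tower_of_smooth (f : R -> R) :
  (forall n x, ex_derive_n f n x) -> tower (Derive_n f).
Proof. intros Hf n x; apply Derive_correct, (Hf (S n) x). Qed.

Lemma tower_shift (F : nat -> R -> R) (k : nat) :
  tower F -> tower (fun n => F (k + n)%nat).
Proof. intros HF n x; rewrite Nat.add_succ_r; apply HF. Qed.

Lemma tower_continuous (F : nat -> R -> R) n x : tower F -> continuous (F n) x.
Proof. intros HF; apply (ex_derive_continuous (F n)); exists (F (S n) x); apply HF. Qed.

Lemma tower_taylor (F : nat -> R -> R) (n : nat) (a b : R) :
  tower F -> a < b ->
  exists z, a < z < b /\
    F 0%nat b = sum_f_R0 (fun m => (b - a) ^ m / INR (fact m) * F m a) n
                + (b - a) ^ S n / INR (fact (S n)) * F (S n) z.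
Proof.
  intros HF Hab.
  destruct (Taylor_Lagrange (F 0%nat) n a b Hab) as [z [Hz Ez]].
  { intros t _ k _; apply tower_ex_derive_n, HF. }
  exists z; split; [exact Hz|].
  rewrite Ez, (tower_Derive_n F HF); f_equal.
  apply sum_eq; intros i _; now rewrite (tower_Derive_n F HF).
Qed.

Lemma tower_mvt (F : nat -> R -> R) (n : nat) (a b : R) :
  tower F -> exists c, Rmin a b <= c <= Rmax a b /\
    F n b - F n a = F (S n) c * (b - a).
Proof.
  intros HF; apply MVT_gen; intros x _; [apply HF|].
  apply continuity_pt_filterlim, (tower_continuous F n x HF).
Qed.

(** * Centred averages *)

(** Convolution of [f] with the normalized indicator of [[-u, u]], written with
    a primitive based at [0] so that derivatives and the mean value theorem
    apply directly. *)
Definition avg (u : R) (f : R -> R) (x : R) : R :=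
  (RInt f 0 (x + u) - RInt f 0 (x - u)) / (2 * u).

Lemma is_derive_primitive (f : R -> R) :
  (forall x, continuous f x) ->
  forall y, is_derive (fun z => RInt f 0 z) y (f y).
Proof.
  intros Hf y; apply (is_derive_RInt f _ 0); [|apply Hf].
  apply filter_forall; intros z; apply (RInt_correct f).
  apply (ex_RInt_continuous f); intros t _; apply Hf.
Qed.

Lemma derive_mvt (f df : R -> R) (a b : R) :
  (forall x, is_derive f x (df x)) ->
  exists c, Rmin a b <= c <= Rmax a b /\ f b - f a = df c * (b - a).
Proof.
  intros Hf; apply MVT_gen; intros x _; [apply Hf|].
  apply continuity_pt_filterlim, (ex_derive_continuous f x).
  exists (df x); apply Hf.
Qed.

Lemma Rabs_between_centered (x u c : R) :
  0 < u -> Rmin (x - u) (x + u) <= c <= Rmax (x - u) (x + u) -> Rabs (c - x) <= u.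
Proof.
  intros Hu; rewrite Rmin_left, Rmax_right by lra; intros Hc; apply Rabs_le; lra.
Qed.

(** The mean value theorem for a primitive of [f - g]. It makes averaging a
    contraction for the uniform norm, and this is what makes iterated averages
    converge. *)
Lemma avg_minus_value (u : R) (f g : R -> R) (x : R) :
  0 < u -> (forall y, continuous f y) -> (forall y, continuous g y) ->
  exists c, Rabs (c - x) <= u /\ avg u f x - avg u g x = f c - g c.
Proof.
  intros Hu Hf Hg.
  destruct (derive_mvt (fun z => RInt f 0 z - RInt g 0 z)
              (fun z => f z - g z) (x - u) (x + u)) as [c [Hc E]].
  { intros z; apply (is_derive_minus (V := R_NormedModule));
      now apply is_derive_primitive. }
  exists c; split; [now apply Rabs_between_centered|].
  unfold avg.
  replace (f c - g c) with ((f c - g c) * (x + u - (x - u)) / (2 * u)) by (field; lra).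
  rewrite <- E; field; lra.
Qed.

Lemma avg_value (u : R) (f : R -> R) (x : R) :
  0 < u -> (forall y, continuous f y) ->
  exists c, Rabs (c - x) <= u /\ avg u f x = f c.
Proof.
  intros Hu Hf.
  destruct (derive_mvt (fun z => RInt f 0 z) f (x - u) (x + u)
             (is_derive_primitive f Hf)) as [c [Hc E]].
  exists c; split; [now apply Rabs_between_centered|].
  unfold avg; rewrite E; field; lra.
Qed.

Lemma is_derive_difference_quotient (g dg : R -> R) (v x : R) :
  0 < v -> (forall y, is_derive g y (dg y)) ->
  is_derive (fun z => (g (z + v) - g (z - v)) / (2 * v)) x
            ((dg (x + v) - dg (x - v)) / (2 * v)).
Proof.
  intros Hv Hg.
  assert (D : forall w, is_derive (fun z => g (z + w)) x (dg (x + w))).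
  { intros w.
    replace (dg (x + w)) with (scal 1 (dg (x + w))) by (unfold scal; simpl; unfold mult; simpl; ring).
    apply (is_derive_comp g (fun z => z + w)); [apply Hg|auto_derive; auto]. }
  apply (is_derive_ext (fun z => scal (/ (2 * v)) (minus (g (z + v)) (g (z + - v))))).
  { intros t; unfold scal, minus, plus, opp; simpl; unfold mult; simpl.
    unfold Rminus, Rdiv; ring. }
  replace ((dg (x + v) - dg (x - v)) / (2 * v))
    with (scal (/ (2 * v)) (minus (dg (x + v)) (dg (x + - v)))).
  2:{ unfold scal, minus, plus, opp; simpl; unfold mult; simpl.
      unfold Rminus, Rdiv; ring. }
  apply (is_derive_scal (fun z => minus (g (z + v)) (g (z + - v)))).
  apply (is_derive_minus (V := R_NormedModule)); apply D.
Qed.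

Lemma avg_derive (u : R) (f : R -> R) (x : R) :
  0 < u -> (forall y, continuous f y) ->
  is_derive (avg u f) x ((f (x + u) - f (x - u)) / (2 * u)).
Proof.
  intros Hu Hf; apply (is_derive_difference_quotient (fun z => RInt f 0 z)); [exact Hu|].
  now apply is_derive_primitive.
Qed.

(** An average of a derivative is a difference quotient. Hence averaging costs
    nothing on a derivative of given order, or lowers the order by one at the
    price of a factor [/ u]. *)
Lemma avg_of_derivative (u : R) (f df : R -> R) (x : R) :
  (forall y, is_derive f y (df y)) -> (forall y, continuous df y) ->
  avg u df x = (f (x + u) - f (x - u)) / (2 * u).
Proof.
  intros Hf Hc; unfold avg.
  assert (E : forall y, RInt df 0 y = f y - f 0).
  { intros y; apply is_RInt_unique, (is_RInt_derive f df); intros t _; auto. }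
  rewrite !E; f_equal; ring.
Qed.

Definition lipschitz (L : R) (f : R -> R) : Prop :=
  forall x y, Rabs (f x - f y) <= L * Rabs (x - y).

Lemma lipschitz_continuous (L : R) (f : R -> R) :
  lipschitz L f -> forall x, continuous f x.
Proof.
  intros Hf x; apply continuity_pt_filterlim.
  intros eps Heps; exists (eps / (Rabs L + 1)).
  pose proof (Rabs_pos L) as HL.
  split; [apply Rdiv_lt_0_compat; lra|].
  intros y [_ Hy]; simpl in *; unfold Rdist in *.
  eapply Rle_lt_trans; [apply Hf|].
  apply (Rmult_lt_compat_r (Rabs L + 1)) in Hy; [|lra].
  replace (eps / (Rabs L + 1) * (Rabs L + 1)) with eps in Hy by (field; lra).
  pose proof (Rle_abs L); pose proof (Rabs_pos (y - x)); nra.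
Qed.

Lemma avg_lipschitz (u L : R) (f : R -> R) :
  0 < u -> lipschitz L f -> lipschitz L (avg u f).
Proof.
  intros Hu Hf x y.
  destruct (derive_mvt (avg u f) _ y x
     (fun z => avg_derive u f z Hu (lipschitz_continuous L f Hf))) as [c [_ E]].
  rewrite E, Rabs_mult; apply Rmult_le_compat_r; [apply Rabs_pos|].
  rewrite Rabs_div by lra; rewrite (Rabs_pos_eq (2 * u)) by lra.
  apply (Rmult_le_reg_r (2 * u)); [lra|].
  replace (Rabs (f (c + u) - f (c - u)) / (2 * u) * (2 * u))
    with (Rabs (f (c + u) - f (c - u))) by (field; lra).
  eapply Rle_trans; [apply Hf|].
  replace (c + u - (c - u)) with (2 * u) by ring.
  rewrite (Rabs_pos_eq (2 * u)) by lra; lra.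
Qed.
(** * Finite sums and products *)

Fixpoint sumto (f : nat -> R) (n : nat) : R :=
  match n with O => 0 | S n' => sumto f n' + f n' end.

Fixpoint prodto (f : nat -> R) (n : nat) : R :=
  match n with O => 1 | S n' => prodto f n' * f n' end.

Lemma sumto_ext (f g : nat -> R) n :
  (forall k, (k < n)%nat -> f k = g k) -> sumto f n = sumto g n.
Proof.
  induction n as [|n IH]; intros H; simpl; [reflexivity|].
  rewrite IH, H; auto.
Qed.

Lemma prodto_ext (f g : nat -> R) n :
  (forall k, (k < n)%nat -> f k = g k) -> prodto f n = prodto g n.
Proof.
  induction n as [|n IH]; intros H; simpl; [reflexivity|].
  rewrite IH, H; auto.
Qed.

Lemma sumto_S_l (f : nat -> R) n : sumto f (S n) = f 0%nat + sumto (fun k => f (S k)) n.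
Proof. induction n as [|n IH]; simpl in *; [ring|rewrite IH; ring]. Qed.

Lemma prodto_S_l (f : nat -> R) n : prodto f (S n) = f 0%nat * prodto (fun k => f (S k)) n.
Proof. induction n as [|n IH]; simpl in *; [ring|rewrite IH; ring]. Qed.

Lemma sumto_add (f : nat -> R) m n :
  sumto f (m + n) = sumto f m + sumto (fun k => f (m + k)%nat) n.
Proof.
  induction n as [|n IH]; [rewrite Nat.add_0_r; simpl; ring|].
  rewrite Nat.add_succ_r; simpl; rewrite IH; ring.
Qed.

Lemma prodto_add (f : nat -> R) m n :
  prodto f (m + n) = prodto f m * prodto (fun k => f (m + k)%nat) n.
Proof.
  induction n as [|n IH]; [rewrite Nat.add_0_r; simpl; ring|].
  rewrite Nat.add_succ_r; simpl; rewrite IH; ring.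
Qed.

Lemma sumto_scal (c : R) (f : nat -> R) n : sumto (fun k => c * f k) n = c * sumto f n.
Proof. induction n as [|n IH]; simpl; [ring|rewrite IH; ring]. Qed.

Lemma sumto_nonneg (f : nat -> R) n : (forall k, 0 <= f k) -> 0 <= sumto f n.
Proof.
  intros H; induction n as [|n IH]; simpl; [lra|]. specialize (H n); lra.
Qed.

Lemma prodto_pos (f : nat -> R) n : (forall k, 0 < f k) -> 0 < prodto f n.
Proof.
  intros H; induction n as [|n IH]; simpl; [lra|]. now apply Rmult_lt_0_compat.
Qed.

Lemma sumto_sum_n (f : nat -> R) n : sumto f (S n) = sum_n f n.
Proof.
  induction n as [|n IH].
  - rewrite sum_O; simpl; ring.
  - rewrite sum_Sn; simpl in *; rewrite IH; reflexivity.
Qed.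

Lemma incr_steps (s : nat -> R) :
  (forall n, s n <= s (S n)) -> forall m n, (m <= n)%nat -> s m <= s n.
Proof.
  intros Hs m n Hmn; induction Hmn as [|n _ IH]; [lra|].
  eapply Rle_trans; [exact IH|apply Hs].
Qed.

Lemma strict_incr_steps (r : nat -> nat) :
  (forall i, (r i < r (S i))%nat) -> forall i j, (i < j)%nat -> (r i < r j)%nat.
Proof.
  intros Hr i j Hij; induction Hij as [|j Hij IH]; [apply Hr|]; specialize (Hr j); lia.
Qed.

Lemma sumto_ge_term (f : nat -> R) (n k : nat) :
  (forall l, 0 <= f l) -> (k < n)%nat -> f k <= sumto f n.
Proof.
  intros Hf Hk; induction n as [|n IH]; [lia|]; cbn [sumto].
  pose proof (Hf n); pose proof (sumto_nonneg f n Hf).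
  destruct (Nat.eq_dec k n) as [->|]; [lra|].
  specialize (IH ltac:(lia)); lra.
Qed.

Lemma sumto_const_le (f : nat -> R) (c : R) (n : nat) :
  (forall k, (k < n)%nat -> c <= f k) -> INR n * c <= sumto f n.
Proof.
  induction n as [|n IH]; intros H; [simpl; lra|].
  rewrite S_INR; cbn [sumto].
  assert (INR n * c <= sumto f n) by (apply IH; auto).
  specialize (H n (Nat.lt_succ_diag_r n)); lra.
Qed.

Lemma sumto_rev (f : nat -> R) (n : nat) :
  sumto (fun i => f (n - S i)%nat) n = sumto f n.
Proof.
  induction n as [|n IH]; [reflexivity|].
  rewrite sumto_S_l; replace (S n - 1)%nat with n by lia.
  rewrite (sumto_ext _ (fun i => f (n - S i)%nat)) by (intros; f_equal; lia).
  rewrite IH; simpl; ring.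
Qed.

Lemma sumto_single (f : nat -> R) (n k : nat) :
  (forall l, l <> k -> f l = 0) -> sumto f n = if le_lt_dec n k then 0 else f k.
Proof.
  intros Hf; induction n as [|n IH]; cbn [sumto]; [destruct (le_lt_dec 0 k); [reflexivity|lia]|].
  rewrite IH; destruct (le_lt_dec n k), (le_lt_dec (S n) k); try lia.
  - rewrite Hf by lia; ring.
  - replace n with k by lia; ring.
  - rewrite (Hf n) by lia; ring.
Qed.

(** * Infinite convolutions of box functions *)

(** The increments of [g] are dominated by those of a convergent monotone
    sequence, so [g] is Cauchy; the explicit error bound gives convergence that
    is uniform in whatever [g] depends on. *)
Lemma limit_of_dominated_steps (g s : nat -> R) (l L : R) :
  0 <= L -> (forall n, s n <= s (S n)) -> is_lim_seq s l ->
  (forall n, Rabs (g (S n) - g n) <= L * (s (S n) - s n)) ->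
  is_lim_seq g (real (Lim_seq g)) /\
  (forall n, Rabs (real (Lim_seq g) - g n) <= L * (l - s n)).
Proof.
  intros HL Hs Hl Hg.
  assert (D : forall n k, Rabs (g (n + k)%nat - g n) <= L * (s (n + k)%nat - s n)).
  { intros n k; induction k as [|k IH].
    - rewrite Nat.add_0_r, !Rminus_diag, Rabs_R0; lra.
    - rewrite Nat.add_succ_r.
      replace (g (S (n + k)) - g n)
        with ((g (S (n + k)) - g (n + k)%nat) + (g (n + k)%nat - g n)) by ring.
      eapply Rle_trans; [apply Rabs_triang|].
      specialize (Hg (n + k)%nat); lra. }
  assert (Hsl : forall n, s n <= l).
  { intros n.
    apply (is_lim_seq_le_loc (fun _ => s n) s (s n) l);
      [|apply is_lim_seq_const|exact Hl].
    exists n; intros m Hm; now apply incr_steps. }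
  assert (E : ex_finite_lim_seq g).
  { apply ex_lim_seq_cauchy_corr; intros eps.
    assert (He : 0 < eps / (2 * (L + 1))).
    { apply Rdiv_lt_0_compat; [apply cond_pos|lra]. }
    assert (Hc : exists n0, forall n, (n0 <= n)%nat -> Rabs (s n - l) < eps / (2 * (L + 1))).
    { apply is_lim_seq_spec in Hl; destruct (Hl (mkposreal _ He)) as [n0 Hn0].
      exists n0; exact Hn0. }
    destruct Hc as [n0 Hn0]; exists n0; intros n m Hn Hm.
    assert (K : forall p, (n0 <= p)%nat -> Rabs (g p - g n0) < eps / 2).
    { intros p Hp; replace p with (n0 + (p - n0))%nat by lia.
      eapply Rle_lt_trans; [apply D|].
      replace (n0 + (p - n0))%nat with p by lia.
      specialize (Hn0 n0 (le_n _)); apply Rabs_lt_between in Hn0.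
      pose proof (Hsl p).
      apply Rle_lt_trans with (L * (eps / (2 * (L + 1)))).
      - apply Rmult_le_compat_l; lra.
      - pose proof (cond_pos eps).
        replace (eps / 2) with ((L + 1) * (eps / (2 * (L + 1)))) by (field; lra).
        nra. }
    replace (g n - g m) with ((g n - g n0) - (g m - g n0)) by ring.
    eapply Rle_lt_trans; [apply Rabs_triang|].
    rewrite Rabs_Ropp; pose proof (K n Hn); pose proof (K m Hm); lra. }
  apply ex_finite_lim_seq_correct in E; destruct E as [E1 E2].
  assert (G : is_lim_seq g (real (Lim_seq g))).
  { rewrite E2; now apply Lim_seq_correct. }
  split; [exact G|]; intros n.
  apply (is_lim_seq_le_loc (fun k => Rabs (g k - g n)) (fun _ => L * (l - s n))
           (Rabs (real (Lim_seq g) - g n)) (L * (l - s n)));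
    [|..|apply is_lim_seq_const].
  - exists n; intros m Hm; replace m with (n + (m - n))%nat by lia.
    eapply Rle_trans; [apply D|].
    apply Rmult_le_compat_l; [exact HL|]; specialize (Hsl (n + (m - n))%nat); lra.
  - apply (is_lim_seq_abs _ (real (Lim_seq g) - g n)).
    apply is_lim_seq_minus'; [exact G|apply is_lim_seq_const].
Qed.

(** [avg (u m)] applied after [avg (u (m+1))], and so on, [n] times. Starting
    the recursion at an arbitrary [m] lets the limits satisfy a recursion in
    [m], see [conv_avg]. *)
Fixpoint conv_approx (u : nat -> R) (f : R -> R) (m n : nat) : R -> R :=
  match n with
  | O => f
  | S n' => avg (u m) (conv_approx u f (S m) n')
  end.

Definition conv (u : nat -> R) (f : R -> R) (m : nat) (x : R) : R :=
  real (Lim_seq (fun n => conv_approx u f m n x)).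

Lemma conv_approx_lipschitz (u : nat -> R) (L : R) (f : R -> R) :
  (forall k, 0 < u k) -> lipschitz L f ->
  forall n m, lipschitz L (conv_approx u f m n).
Proof.
  intros Hu Hf n; induction n as [|n IH]; intros m; simpl; [exact Hf|].
  now apply avg_lipschitz.
Qed.

(** A composition of averages is still a value of [f] at a nearby point. Bounds,
    support and regions of constancy of [f] therefore pass to the convolutions
    up to the total width of the boxes. *)
Lemma conv_approx_value (u : nat -> R) (L : R) (f : R -> R) :
  (forall k, 0 < u k) -> lipschitz L f ->
  forall n m x, exists c,
    Rabs (c - x) <= sumto (fun k => u (m + k)%nat) n /\ conv_approx u f m n x = f c.
Proof.
  intros Hu Hf n; induction n as [|n IH]; intros m x.
  - exists x; rewrite Rminus_diag, Rabs_R0; simpl; split; [lra|reflexivity].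
  - destruct (avg_value (u m) (conv_approx u f (S m) n) x (Hu m)) as [d [Hd Ed]].
    { apply lipschitz_continuous with L; now apply conv_approx_lipschitz. }
    destruct (IH (S m) d) as [c [Hc Ec]].
    exists c; split; [|simpl; now rewrite Ed, Ec].
    rewrite sumto_S_l, Nat.add_0_r.
    rewrite (sumto_ext (fun k => u (m + S k)%nat) (fun k => u (S m + k)%nat))
      by (intros; f_equal; lia).
    replace (c - x) with ((c - d) + (d - x)) by ring.
    eapply Rle_trans; [apply Rabs_triang|lra].
Qed.

Lemma conv_approx_step (u : nat -> R) (L : R) (f : R -> R) :
  0 <= L -> (forall k, 0 < u k) -> lipschitz L f ->
  forall n m x,
    Rabs (conv_approx u f m (S n) x - conv_approx u f m n x) <= L * u (m + n)%nat.
Proof.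
  intros HL Hu Hf n; induction n as [|n IH]; intros m x.
  - simpl; rewrite Nat.add_0_r.
    destruct (avg_value (u m) f x (Hu m)) as [c [Hc Ec]].
    { now apply lipschitz_continuous with L. }
    rewrite Ec; eapply Rle_trans; [apply Hf|now apply Rmult_le_compat_l].
  - change (conv_approx u f m (S (S n)))
      with (avg (u m) (conv_approx u f (S m) (S n))).
    change (conv_approx u f m (S n)) with (avg (u m) (conv_approx u f (S m) n)).
    destruct (avg_minus_value (u m) (conv_approx u f (S m) (S n))
                (conv_approx u f (S m) n) x (Hu m)) as [c [_ Ec]];
      try (apply lipschitz_continuous with L; now apply conv_approx_lipschitz).
    rewrite Ec; replace (m + S n)%nat with (S m + n)%nat by lia; apply IH.
Qed.

Lemma conv_limit (u : nat -> R) (L S0 : R) (f : R -> R) :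
  0 <= L -> (forall k, 0 < u k) -> (forall n, sumto u n <= S0) -> lipschitz L f ->
  forall m, exists r : nat -> R, is_lim_seq r 0 /\
    forall x, is_lim_seq (fun n => conv_approx u f m n x) (conv u f m x) /\
      forall n, Rabs (conv u f m x - conv_approx u f m n x) <= r n.
Proof.
  intros HL Hu HS Hf m.
  pose (s := sumto (fun k => u (m + k)%nat)).
  assert (Hs : forall n, s n <= s (S n)).
  { intros n; unfold s; simpl; specialize (Hu (m + n)%nat); lra. }
  destruct (ex_finite_lim_seq_incr s S0 Hs) as [l Hl].
  { intros n; unfold s; apply Rle_trans with (sumto u (m + n)); [|apply HS].
    rewrite sumto_add.
    pose proof (sumto_nonneg u m (fun k => Rlt_le _ _ (Hu k))); lra. }
  exists (fun n => L * (l - s n)); split.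
  - replace (Finite 0) with (Rbar_mult L (Finite (l - l))) by (simpl; f_equal; ring).
    apply is_lim_seq_scal_l, is_lim_seq_minus'; [apply is_lim_seq_const|exact Hl].
  - intros x; apply (limit_of_dominated_steps _ s l L HL Hs Hl).
    intros n; eapply Rle_trans; [apply conv_approx_step with (L := L); assumption|].
    unfold s; simpl; apply Req_le; ring.
Qed.

Lemma conv_lipschitz (u : nat -> R) (L S0 : R) (f : R -> R) :
  0 <= L -> (forall k, 0 < u k) -> (forall n, sumto u n <= S0) -> lipschitz L f ->
  forall m, lipschitz L (conv u f m).
Proof.
  intros HL Hu HS Hf m x y.
  destruct (conv_limit u L S0 f HL Hu HS Hf m) as [r [_ Hr]].
  apply (is_lim_seq_le (fun n => Rabs (conv_approx u f m n x - conv_approx u f m n y))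
           (fun _ => L * Rabs (x - y)) (Rabs (conv u f m x - conv u f m y))
           (L * Rabs (x - y))); [|..|apply is_lim_seq_const].
  - intros n; now apply conv_approx_lipschitz.
  - apply (is_lim_seq_abs _ (conv u f m x - conv u f m y)).
    apply is_lim_seq_minus'; apply Hr.
Qed.

(** The fixed-point equation that replaces differentiation under the limit: it
    exhibits the derivative of [conv u f m] as a difference quotient of
    [conv u f (m+1)], so smoothness follows by iteration. *)
Lemma conv_avg (u : nat -> R) (L S0 : R) (f : R -> R) :
  0 <= L -> (forall k, 0 < u k) -> (forall n, sumto u n <= S0) -> lipschitz L f ->
  forall m x, conv u f m x = avg (u m) (conv u f (S m)) x.
Proof.
  intros HL Hu HS Hf m x.
  destruct (conv_limit u L S0 f HL Hu HS Hf m) as [rm [_ Hm]].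
  destruct (conv_limit u L S0 f HL Hu HS Hf (S m)) as [r [Hr0 Hr]].
  destruct (Hm x) as [Hx _].
  apply is_lim_seq_incr_1 in Hx.
  assert (Hy : is_lim_seq (fun n => conv_approx u f m (S n) x) (avg (u m) (conv u f (S m)) x)).
  { apply is_lim_seq_spec; intros eps.
    apply is_lim_seq_spec in Hr0; destruct (Hr0 eps) as [n0 Hn0].
    exists n0; intros n Hn; specialize (Hn0 n Hn).
    simpl; destruct (avg_minus_value (u m) (conv_approx u f (S m) n) (conv u f (S m)) x (Hu m))
      as [c [_ Ec]].
    - apply lipschitz_continuous with L; now apply conv_approx_lipschitz.
    - apply lipschitz_continuous with L; now apply conv_lipschitz with S0.
    - rewrite Ec, Rabs_minus_sym.
      eapply Rle_lt_trans; [apply Hr|].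
      rewrite Rminus_0_r in Hn0; eapply Rle_lt_trans; [apply Rle_abs|exact Hn0]. }
  apply is_lim_seq_unique in Hx; apply is_lim_seq_unique in Hy.
  rewrite Hx in Hy; now injection Hy.
Qed.

Lemma conv_range (u : nat -> R) (L S0 lo hi : R) (f : R -> R) (x : R) :
  0 <= L -> (forall k, 0 < u k) -> (forall n, sumto u n <= S0) -> lipschitz L f ->
  (forall y, Rabs (y - x) <= S0 -> lo <= f y <= hi) ->
  forall m, lo <= conv u f m x <= hi.
Proof.
  intros HL Hu HS Hf Hy m.
  destruct (conv_limit u L S0 f HL Hu HS Hf m) as [rm [_ Hm]].
  assert (H : forall n, lo <= conv_approx u f m n x <= hi).
  { intros n; destruct (conv_approx_value u L f Hu Hf n m x) as [c [Hc Ec]].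
    rewrite Ec; apply Hy; eapply Rle_trans; [exact Hc|].
    eapply Rle_trans; [|apply (HS (m + n)%nat)].
    rewrite sumto_add; pose proof (sumto_nonneg u m (fun k => Rlt_le _ _ (Hu k))); lra. }
  split.
  - apply (is_lim_seq_le (fun _ => lo) (fun n => conv_approx u f m n x) lo (conv u f m x));
      [apply H|apply is_lim_seq_const|apply Hm].
  - apply (is_lim_seq_le (fun n => conv_approx u f m n x) (fun _ => hi) (conv u f m x) hi);
      [apply H|apply Hm|apply is_lim_seq_const].
Qed.

Fixpoint conv_derivs (u : nat -> R) (f : R -> R) (m n : nat) (x : R) : R :=
  match n with
  | O => conv u f m x
  | S n' => (conv_derivs u f (S m) n' (x + u m) - conv_derivs u f (S m) n' (x - u m))
            / (2 * u m)
  end.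

Lemma conv_derivs_tower (u : nat -> R) (L S0 : R) (f : R -> R) :
  0 <= L -> (forall k, 0 < u k) -> (forall n, sumto u n <= S0) -> lipschitz L f ->
  forall m, tower (conv_derivs u f m).
Proof.
  intros HL Hu HS Hf m n; revert m; induction n as [|n IH]; intros m x.
  - simpl.
    apply (is_derive_ext (avg (u m) (conv u f (S m)))).
    { intros t; symmetry; now apply conv_avg with L S0. }
    apply avg_derive; [apply Hu|].
    apply lipschitz_continuous with L; now apply conv_lipschitz with S0.
  - change (conv_derivs u f m (S (S n)) x) with
      ((conv_derivs u f (S m) (S n) (x + u m) - conv_derivs u f (S m) (S n) (x - u m)) / (2 * u m)).
    apply (is_derive_difference_quotient (conv_derivs u f (S m) n)); [apply Hu|].
    intros y; apply IH.
Qed.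

Lemma Rabs_difference_quotient (a b v B : R) :
  0 < v -> Rabs a <= B -> Rabs b <= B -> Rabs ((a - b) / (2 * v)) <= / v * B.
Proof.
  intros Hv Ha Hb.
  rewrite Rabs_div by lra; rewrite (Rabs_pos_eq (2 * v)) by lra.
  apply (Rmult_le_reg_r (2 * v)); [lra|].
  replace (Rabs (a - b) / (2 * v) * (2 * v)) with (Rabs (a - b)) by (field; lra).
  replace (/ v * B * (2 * v)) with (2 * B) by (field; lra).
  unfold Rminus; eapply Rle_trans; [apply Rabs_triang|]; rewrite Rabs_Ropp; lra.
Qed.

Lemma conv_derivs_bound (u : nat -> R) (f : R -> R) :
  (forall k, 0 < u k) -> (forall m x, Rabs (conv u f m x) <= 1) ->
  forall n m x, Rabs (conv_derivs u f m n x) <= prodto (fun k => / u (m + k)%nat) n.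
Proof.
  intros Hu Hf n; induction n as [|n IH]; intros m x; simpl; [apply Hf|].
  change (prodto (fun k => / u (m + k)%nat) n * / u (m + n)%nat)
    with (prodto (fun k => / u (m + k)%nat) (S n)).
  rewrite prodto_S_l, Nat.add_0_r.
  rewrite (prodto_ext (fun k => / u (m + S k)%nat) (fun k => / u (S m + k)%nat))
    by (intros; do 2 f_equal; lia).
  apply Rabs_difference_quotient; [apply Hu|apply IH|apply IH].
Qed.
(** * Cut-off functions *)

Fixpoint avg_tower (v : R) (F : nat -> R -> R) (k n : nat) : R -> R :=
  match k with O => F n | S k' => avg v (avg_tower v F k' n) end.

Lemma avg_tower_tower (v : R) (F : nat -> R -> R) :
  0 < v -> tower F -> forall k, tower (avg_tower v F k).
Proof.
  intros Hv HF k; induction k as [|k IH]; [exact HF|]; intros n x; simpl.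
  rewrite (avg_of_derivative v (avg_tower v F k n)).
  - apply avg_derive; [exact Hv|intros y; now apply tower_continuous].
  - intros y; apply IH.
  - intros y; now apply tower_continuous.
Qed.

(** Averaging [k] more times allows up to [l <= k] derivatives to be paid with
    factors [/ v] while the other [n] are paid with the bounds of [F]. Both
    kinds must be available at once: this freedom of choice is what a product
    with a monomial requires in [localized_monomial]. *)
Lemma avg_tower_bound (v : R) (F : nat -> R -> R) (B : nat -> R) :
  0 < v -> tower F -> (forall n x, Rabs (F n x) <= B n) ->
  forall k n l x, (l <= k)%nat -> Rabs (avg_tower v F k (n + l) x) <= (/ v) ^ l * B n.
Proof.
  intros Hv HF HB k; induction k as [|k IH]; intros n l x Hl.
  - replace l with 0%nat by lia; rewrite Nat.add_0_r; simpl; rewrite Rmult_1_l; apply HB.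
  - pose proof (avg_tower_tower v F Hv HF k) as Tk.
    destruct l as [|l]; simpl.
    + destruct (avg_value v (avg_tower v F k (n + 0)) x Hv) as [c [_ E]].
      { intros y; now apply tower_continuous. }
      rewrite E; apply (IH n 0%nat); lia.
    + rewrite Nat.add_succ_r, (avg_of_derivative v (avg_tower v F k (n + l))).
      * rewrite Rmult_assoc; apply Rabs_difference_quotient; [exact Hv|apply IH; lia|apply IH; lia].
      * intros y; apply Tk.
      * intros y; now apply tower_continuous.
Qed.

Lemma avg_tower_value (v : R) (F : nat -> R -> R) :
  0 < v -> tower F ->
  forall k n x, exists c, Rabs (c - x) <= INR k * v /\ avg_tower v F k n x = F n c.
Proof.
  intros Hv HF k n; induction k as [|k IH]; intros x.
  - exists x; rewrite Rminus_diag, Rabs_R0; simpl; split; [lra|reflexivity].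
  - destruct (avg_value v (avg_tower v F k n) x Hv) as [d [Hd Ed]].
    { intros y; apply tower_continuous; now apply avg_tower_tower. }
    destruct (IH d) as [c [Hc Ec]]; exists c; split; [|simpl; now rewrite Ed, Ec].
    rewrite S_INR; replace (c - x) with ((c - d) + (d - x)) by ring.
    eapply Rle_trans; [apply Rabs_triang|lra].
Qed.

Definition trapezoid (rho x : R) : R := Rmax 0 (Rmin 1 (3 - Rabs x / rho)).

Lemma trapezoid_range (rho x : R) : 0 <= trapezoid rho x <= 1.
Proof.
  unfold trapezoid; split; [apply Rmax_l|].
  apply Rmax_lub; [lra|apply Rmin_l].
Qed.

Lemma trapezoid_lipschitz (rho : R) : 0 < rho -> lipschitz (/ rho) (trapezoid rho).
Proof.
  intros Hr x y; unfold trapezoid, Rdiv.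
  pose proof (Rinv_0_lt_compat rho Hr) as Hi.
  assert (H : Rabs (Rabs x * / rho - Rabs y * / rho) <= / rho * Rabs (x - y)).
  { rewrite <- Rmult_minus_distr_r, Rabs_mult, (Rabs_pos_eq (/ rho)), Rmult_comm by lra.
    apply Rmult_le_compat_l; [lra|apply Rabs_triang_inv2]. }
  revert H; generalize (/ rho * Rabs (x - y)), (Rabs x * / rho), (Rabs y * / rho).
  intros b s t H; apply Rabs_le_between in H; apply Rabs_le.
  unfold Rmin; destruct (Rle_dec 1 (3 - s)), (Rle_dec 1 (3 - t)); unfold Rmax;
    repeat match goal with |- context [Rle_dec ?p ?q] => destruct (Rle_dec p q) end;
    split; lra.
Qed.

Lemma trapezoid_one (rho x : R) : 0 < rho -> Rabs x <= 2 * rho -> trapezoid rho x = 1.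
Proof.
  intros Hr Hx; unfold trapezoid.
  assert (Rabs x / rho <= 2) by (apply (Rle_div_l _ _ rho); lra).
  rewrite Rmin_left by lra; apply Rmax_right; lra.
Qed.

Lemma trapezoid_zero (rho x : R) : 0 < rho -> 3 * rho <= Rabs x -> trapezoid rho x = 0.
Proof.
  intros Hr Hx; unfold trapezoid.
  assert (3 <= Rabs x / rho) by (apply (Rle_div_r _ _ rho); lra).
  rewrite Rmin_right by lra; apply Rmax_left; lra.
Qed.

(** The [p] boxes of width [v] control the derivatives of order up to [p], and
    the boxes of widths [u k] control the higher ones. *)
Lemma cutoff (u : nat -> R) (v rho : R) (p : nat) :
  (forall k, 0 < u k) -> 0 < v -> 0 < rho ->
  (forall n, INR p * v + sumto u n <= rho) ->
  exists F, tower F /\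
    (forall x, Rabs x <= rho -> F 0%nat x = 1) /\
    (forall x, 4 * rho <= Rabs x -> F 0%nat x = 0) /\
    (forall l n x, (l <= p)%nat ->
       Rabs (F (n + l)%nat x) <= (/ v) ^ l * prodto (fun k => / u k) n).
Proof.
  intros Hu Hv Hr HS.
  pose (f := trapezoid rho).
  assert (HL : 0 <= / rho) by (apply Rlt_le, Rinv_0_lt_compat, Hr).
  assert (HS' : forall n, sumto u n <= rho - INR p * v) by (intros n; specialize (HS n); lra).
  pose proof (trapezoid_lipschitz rho Hr) as Hf.
  assert (T : tower (conv_derivs u f 0)) by now apply conv_derivs_tower with (/ rho) (rho - INR p * v).
  exists (avg_tower v (conv_derivs u f 0) p); split; [now apply avg_tower_tower|].
  assert (V : forall x lo hi, (forall y, Rabs (y - x) <= rho -> lo <= f y <= hi) ->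
     lo <= avg_tower v (conv_derivs u f 0) p 0 x <= hi).
  { intros x lo hi H.
    destruct (avg_tower_value v _ Hv T p 0 x) as [c [Hc E]]; rewrite E; simpl.
    apply conv_range with (/ rho) (rho - INR p * v); try assumption.
    intros y Hy; apply H.
    replace (y - x) with ((y - c) + (c - x)) by ring.
    eapply Rle_trans; [apply Rabs_triang|lra]. }
  split; [|split].
  - intros x Hx; assert (1 <= avg_tower v (conv_derivs u f 0) p 0 x <= 1); [|lra].
    apply V; intros y Hy; unfold f; rewrite trapezoid_one; [lra|exact Hr|].
    replace y with ((y - x) + x) by ring.
    eapply Rle_trans; [apply Rabs_triang|lra].
  - intros x Hx; assert (0 <= avg_tower v (conv_derivs u f 0) p 0 x <= 0); [|lra].
    apply V; intros y Hy; unfold f; rewrite trapezoid_zero; [lra|exact Hr|].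
    pose proof (Rabs_triang_inv x y) as Ht; rewrite Rabs_minus_sym in Ht; lra.
  - intros l n x Hl.
    apply (avg_tower_bound v _ (fun n => prodto (fun k => / u k) n) Hv T); [|exact Hl].
    intros k y; apply (conv_derivs_bound u f Hu).
    intros m z.
    assert (0 <= conv u f m z <= 1); [|apply Rabs_le; lra].
    apply conv_range with (/ rho) (rho - INR p * v); try assumption.
    intros t _; apply trapezoid_range.
Qed.

Lemma tower_zero_where_constant (F : nat -> R -> R) (D : R -> Prop) (c : R) :
  tower F -> (forall x, D x -> locally x D) -> (forall x, D x -> F 0%nat x = c) ->
  forall n x, D x -> F (S n) x = 0.
Proof.
  intros HF HD Hc.
  assert (H : forall n, exists d, forall x, D x -> F n x = d).
  { intros n; induction n as [|n [d IH]]; [now exists c|].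
    exists 0; intros x Hx.
    rewrite <- (is_derive_unique _ _ _ (HF n x)).
    rewrite (Derive_ext_loc _ (fun _ => d)); [apply Derive_const|].
    apply (filter_imp D); [exact IH|auto]. }
  intros n x Hx; destruct (H n) as [d Hd].
  rewrite <- (is_derive_unique _ _ _ (HF n x)).
  rewrite (Derive_ext_loc _ (fun _ => d)); [apply Derive_const|].
  apply (filter_imp D); [exact Hd|auto].
Qed.

Lemma locally_Rabs_lt (r x : R) : Rabs x < r -> locally x (fun y => Rabs y < r).
Proof.
  intros Hx; assert (H : 0 < r - Rabs x) by lra; exists (mkposreal _ H).
  intros y Hy; change (Rabs (y - x) < r - Rabs x) in Hy.
  replace y with ((y - x) + x) by ring.
  eapply Rle_lt_trans; [apply Rabs_triang|lra].
Qed.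

Lemma locally_Rabs_gt (r x : R) : r < Rabs x -> locally x (fun y => r < Rabs y).
Proof.
  intros Hx; assert (H : 0 < Rabs x - r) by lra; exists (mkposreal _ H).
  intros y Hy; change (Rabs (y - x) < Rabs x - r) in Hy.
  pose proof (Rabs_triang_inv x y) as Ht; rewrite Rabs_minus_sym in Ht; lra.
Qed.

(** * Cut-off monomials *)

(** The Leibniz formula unfolded into its [2 ^ n] terms: derivatives and bounds
    follow by structural induction, without binomial identities. *)
Fixpoint leibniz (F Q : nat -> R -> R) (n : nat) (x : R) : R :=
  match n with
  | O => F 0%nat x * Q 0%nat x
  | S n' => leibniz (fun k => F (S k)) Q n' x + leibniz F (fun k => Q (S k)) n' x
  end.

Lemma leibniz_tower (F Q : nat -> R -> R) :
  tower F -> tower Q -> tower (leibniz F Q).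
Proof.
  intros HF HQ n; revert F Q HF HQ; induction n as [|n IH]; intros F Q HF HQ x.
  - simpl.
    apply (is_derive_mult (F 0%nat) (Q 0%nat) x (F 1%nat x) (Q 1%nat x));
      [apply HF|apply HQ|intros; apply Rmult_comm].
  - change (leibniz F Q (S (S n)) x) with
      (plus (leibniz (fun k => F (S k)) Q (S n) x) (leibniz F (fun k => Q (S k)) (S n) x)).
    apply (is_derive_plus (V := R_NormedModule)); apply IH; try assumption;
      now apply (tower_shift _ 1).
Qed.

Lemma leibniz_bound (B x : R) (n : nat) : forall (F Q : nat -> R -> R),
  (forall a b, (a + b = n)%nat -> Rabs (F a x * Q b x) <= B) ->
  Rabs (leibniz F Q n x) <= 2 ^ n * B.
Proof.
  induction n as [|n IH]; intros F Q H; simpl.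
  - rewrite Rmult_1_l; now apply H.
  - eapply Rle_trans; [apply Rabs_triang|].
    assert (H1 := IH (fun k => F (S k)) Q (fun a b e => H (S a) b (f_equal S e))).
    assert (H2 : Rabs (leibniz F (fun k => Q (S k)) n x) <= 2 ^ n * B).
    { apply IH; intros a b e; apply H; lia. }
    lra.
Qed.

Lemma leibniz_zero_l (x : R) (n : nat) : forall (F Q : nat -> R -> R),
  (forall k, F k x = 0) -> leibniz F Q n x = 0.
Proof.
  induction n as [|n IH]; intros F Q H; simpl; [rewrite H; ring|].
  rewrite !IH; [ring|exact H|intros k; apply H].
Qed.

Lemma leibniz_one_l (x : R) (n : nat) : forall (F Q : nat -> R -> R),
  F 0%nat x = 1 -> (forall k, F (S k) x = 0) -> leibniz F Q n x = Q n x.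
Proof.
  induction n as [|n IH]; intros F Q H0 H; simpl; [rewrite H0; ring|].
  rewrite leibniz_zero_l, IH; auto; ring.
Qed.

(** The [k]-th derivative of [x ^ p / p!]. *)
Definition mono (p k : nat) (x : R) : R :=
  if le_dec k p then x ^ (p - k) / INR (fact (p - k)) else 0.

Lemma mono_tower (p : nat) : tower (mono p).
Proof.
  intros k x; unfold mono.
  destruct (le_dec (S k) p) as [H|H], (le_dec k p) as [H'|H']; try lia.
  - replace (p - k)%nat with (S (p - S k)) by lia.
    generalize (p - S k)%nat; intros m.
    auto_derive; [exact I|].
    change (1 * (INR (S m) * x ^ m) * / INR (fact (S m)) = x ^ m / INR (fact m)).
    rewrite fact_simpl, mult_INR, S_INR.
    pose proof (INR_fact_lt_0 m); pose proof (pos_INR m).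
    field; lra.
  - replace (p - k)%nat with 0%nat by lia; simpl.
    apply (is_derive_const (V := R_NormedModule)).
  - apply (is_derive_const (V := R_NormedModule)).
Qed.

Lemma mono_zero (p k : nat) : mono p k 0 = if Nat.eq_dec k p then 1 else 0.
Proof.
  unfold mono; destruct (le_dec k p) as [H|H], (Nat.eq_dec k p) as [E|E]; try lia; try reflexivity.
  - subst; rewrite Nat.sub_diag; simpl; field.
  - rewrite pow_i by lia; unfold Rdiv; ring.
Qed.
Lemma pow_div_fact_le_exp (x : R) (m : nat) : 0 <= x -> x ^ m / INR (fact m) <= exp x.
Proof.
  intros Hx; eapply Rle_trans; [|apply (exp_ge_taylor x m Hx)].
  assert (P : forall k, 0 <= x ^ k / INR (fact k)).
  { intros k; apply Rdiv_le_0_compat; [now apply pow_le|apply INR_fact_lt_0]. }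
  destruct m as [|m]; simpl; [lra|].
  pose proof (cond_pos_sum (fun k => x ^ k / INR (fact k)) m P) as Hs.
  simpl in Hs; lra.
Qed.

Lemma prodto_inv_scal (eps : R) (w : nat -> R) (n : nat) :
  prodto (fun k => / (eps * w k)) n = (/ eps) ^ n * prodto (fun k => / w k) n.
Proof.
  induction n as [|n IH]; simpl; [ring|].
  rewrite IH, Rinv_mult; ring.
Qed.

Lemma Rinv_pow_mult (v : R) (n : nat) : 0 < v -> (/ v) ^ n * v ^ n = 1.
Proof. intros Hv; rewrite <- Rpow_mult_distr, Rinv_l by lra; apply pow1. Qed.

(** A function with the jet of [x ^ p / p!] at [0] and support of size
    comparable to [eps * t]. In the Leibniz formula, a factor
    [x ^ (p - b) / (p - b)!] on this support is at most
    [v ^ (p - b) * exp (8 (p + 1))], where [v] is the width of the [p] equal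
    boxes, so it compensates exactly [p - b] derivatives of the cut-off paid
    with [/ v]. If the order of differentiation is at most [p], then all derivatives of
    the cut-off are paid in this way and the power of [v] that remains is
    [p - j]; if the order is [p + n], then exactly [n] derivatives are left for
    the boxes [eps * w]. *)
Lemma localized_monomial (w : nat -> R) (t eps : R) (p : nat) :
  (forall k, 0 < w k) -> 0 < t -> 0 < eps ->
  (forall n, sumto (fun k => w (p + k)%nat) n <= t) ->
  exists F, tower F /\
    (forall n x, 8 * eps * t < Rabs x -> F n x = 0) /\
    (forall n, F n 0 = if Nat.eq_dec n p then 1 else 0) /\
    (forall j x, (j <= p)%nat ->
       Rabs (F j x) <= 2 ^ j * (exp (8 * (INR p + 1)) * (eps * t / (INR p + 1)) ^ (p - j))) /\
    (forall n x,
       Rabs (F (p + n)%nat x) <= 2 ^ (p + n) * (exp (8 * (INR p + 1)) *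
         ((/ eps) ^ n * prodto (fun k => / w (p + k)%nat) n))).
Proof.
  intros Hw Ht He Hs.
  pose proof (pos_INR p) as Hp.
  set (v := eps * t / (INR p + 1)).
  set (E := exp (8 * (INR p + 1))).
  assert (Het : 0 < eps * t) by now apply Rmult_lt_0_compat.
  assert (Hv : 0 < v) by (apply Rdiv_lt_0_compat; lra).
  assert (Ev : eps * t = (INR p + 1) * v) by (unfold v; field; lra).
  destruct (cutoff (fun k => eps * w (p + k)%nat) v (2 * (eps * t)) p) as [G [TG [G1 [G0 GB]]]].
  { intros k; now apply Rmult_lt_0_compat. }
  { exact Hv. }
  { lra. }
  { intros n; rewrite sumto_scal; specialize (Hs n).
    apply (Rmult_le_compat_l eps) in Hs; [|lra].
    rewrite Ev in *; nra. }
  assert (Gout : forall n x, 8 * eps * t < Rabs x -> G n x = 0).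
  { intros [|n] x Hx; [apply G0; lra|].
    apply (tower_zero_where_constant G (fun y => 8 * eps * t < Rabs y) 0 TG); [| |exact Hx].
    - intros y; apply locally_Rabs_gt.
    - intros y Hy; apply G0; lra. }
  assert (GM : forall a b x K, (b <= p)%nat -> Rabs (G a x) <= K ->
     Rabs (G a x * mono p b x) <= K * (v ^ (p - b) * E)).
  { intros a b x K Hb HK.
    assert (HK0 : 0 <= K) by (eapply Rle_trans; [apply Rabs_pos|exact HK]).
    assert (HvE : 0 <= v ^ (p - b) * E).
    { apply Rmult_le_pos; [apply pow_le; lra|apply Rlt_le, exp_pos]. }
    destruct (Rle_lt_dec (Rabs x) (8 * eps * t)) as [Hx|Hx].
    2:{ rewrite Gout by exact Hx; rewrite Rmult_0_l, Rabs_R0; now apply Rmult_le_pos. }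
    rewrite Rabs_mult; apply Rmult_le_compat; try apply Rabs_pos; [exact HK|].
    unfold mono; destruct (le_dec b p) as [_|]; [|lia].
    generalize (p - b)%nat; intros m.
    pose proof (INR_fact_lt_0 m) as Hf.
    rewrite Rabs_div, (Rabs_pos_eq (INR (fact m))), <- RPow_abs by lra.
    apply Rle_trans with ((v * (8 * (INR p + 1))) ^ m / INR (fact m)).
    - apply Rmult_le_compat_r; [apply Rlt_le, Rinv_0_lt_compat, Hf|].
      apply pow_incr; split; [apply Rabs_pos|lra].
    - rewrite Rpow_mult_distr; unfold Rdiv; rewrite Rmult_assoc.
      apply Rmult_le_compat_l; [apply pow_le; lra|].
      apply pow_div_fact_le_exp; lra. }
  assert (GMout : forall a b x, (p < b)%nat -> G a x * mono p b x = 0).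
  { intros a b x Hb; unfold mono; destruct (le_dec b p); [lia|ring]. }
  exists (leibniz G (mono p)); split; [|split; [|split; [|split]]].
  - apply leibniz_tower; [exact TG|apply mono_tower].
  - intros n x Hx; apply leibniz_zero_l; intros k; now apply Gout.
  - intros n; rewrite leibniz_one_l.
    + apply mono_zero.
    + apply G1; rewrite Rabs_R0; lra.
    + intros k.
      apply (tower_zero_where_constant G (fun y => Rabs y < 2 * (eps * t)) 1 TG).
      * intros y; apply locally_Rabs_lt.
      * intros y Hy; apply G1; lra.
      * rewrite Rabs_R0; lra.
  - intros j x Hj; apply leibniz_bound; intros a b Hab.
    eapply Rle_trans.
    + apply (GM a b x ((/ v) ^ a)); [lia|].
      specialize (GB a 0%nat x); simpl in GB; rewrite Rmult_1_r in GB; apply GB; lia.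
    + replace (p - b)%nat with (a + (p - j))%nat by lia.
      rewrite pow_add.
      replace ((/ v) ^ a * (v ^ a * v ^ (p - j) * E))
        with (((/ v) ^ a * v ^ a) * (E * v ^ (p - j))) by ring.
      rewrite Rinv_pow_mult by exact Hv; lra.
  - intros n x; apply leibniz_bound; intros a b Hab.
    assert (HE : 0 <= E * ((/ eps) ^ n * prodto (fun k => / w (p + k)%nat) n)).
    { apply Rmult_le_pos; [apply Rlt_le, exp_pos|].
      apply Rmult_le_pos; [apply pow_le, Rlt_le, Rinv_0_lt_compat, He|].
      apply Rlt_le, prodto_pos; intros k; apply Rinv_0_lt_compat, Hw. }
    destruct (le_lt_dec b p) as [Hb|Hb]; [|rewrite GMout, Rabs_R0; assumption].
    eapply Rle_trans.
    + apply GM; [exact Hb|].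
      replace a with (n + (p - b))%nat by lia; apply GB; lia.
    + rewrite (prodto_inv_scal eps (fun k => w (p + k)%nat)).
      set (Pi := prodto _ n).
      replace ((/ v) ^ (p - b) * ((/ eps) ^ n * Pi) * (v ^ (p - b) * E))
        with (((/ v) ^ (p - b) * v ^ (p - b)) * (E * ((/ eps) ^ n * Pi))) by ring.
      rewrite Rinv_pow_mult by exact Hv; lra.
Qed.

(** * Series of smooth functions *)

Lemma series_geometric_bound (u : nat -> R) (K : R) :
  (forall p, Rabs (u p) <= K * (1 / 2) ^ p) ->
  ex_series u /\ Rabs (Series u) <= 2 * K.
Proof.
  intros Hu.
  assert (Hg : Rabs (1 / 2) < 1) by (rewrite Rabs_pos_eq; lra).
  assert (Eg : ex_series (fun p => K * (1 / 2) ^ p)).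
  { apply (ex_series_scal (V := R_NormedModule)), ex_series_geom, Hg. }
  assert (Ea : ex_series (fun p => Rabs (u p))).
  { apply (ex_series_le (V := R_CompleteNormedModule)) with (2 := Eg).
    intros n; unfold norm; simpl; unfold abs; simpl; rewrite Rabs_Rabsolu; apply Hu. }
  split; [now apply ex_series_Rabs|].
  eapply Rle_trans; [now apply Series_Rabs|].
  eapply Rle_trans; [apply Series_le with (2 := Eg)|].
  - intros n; split; [apply Rabs_pos|apply Hu].
  - rewrite Series_scal_l, Series_geom by exact Hg; lra.
Qed.

Lemma is_derive_of_quadratic_error (f : R -> R) (x l K : R) :
  (forall y, Rabs (f y - f x - l * (y - x)) <= K * (y - x) ^ 2) -> is_derive f x l.
Proof.
  intros H; apply is_derive_Reals; intros eps Heps.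
  assert (HK : 0 < Rabs K + 1) by (pose proof (Rabs_pos K); lra).
  assert (Hd : 0 < eps / (Rabs K + 1)) by (apply Rdiv_lt_0_compat; lra).
  exists (mkposreal _ Hd); intros h Hh Hhd; simpl in Hhd.
  specialize (H (x + h)); replace (x + h - x) with h in H by ring.
  replace ((f (x + h) - f x) / h - l) with ((f (x + h) - f x - l * h) / h) by (field; exact Hh).
  pose proof (Rabs_pos_lt h Hh) as Hp.
  rewrite Rabs_div by exact Hh.
  apply (Rmult_lt_reg_r (Rabs h)); [exact Hp|].
  replace (Rabs (f (x + h) - f x - l * h) / Rabs h * Rabs h)
    with (Rabs (f (x + h) - f x - l * h)) by (field; lra).
  eapply Rle_lt_trans; [exact H|].
  apply (Rmult_lt_compat_r (Rabs K + 1)) in Hhd; [|exact HK].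
  replace (eps / (Rabs K + 1) * (Rabs K + 1)) with eps in Hhd by (field; lra).
  rewrite <- pow2_abs; pose proof (Rle_abs K); nra.
Qed.

Lemma tower_quadratic_error (F : nat -> R -> R) (K : R) (j : nat) (x y : R) :
  tower F -> (forall z, Rabs (F (S (S j)) z) <= K) ->
  Rabs (F j y - F j x - F (S j) x * (y - x)) <= K * (y - x) ^ 2.
Proof.
  intros HF HK.
  destruct (tower_mvt F j x y HF) as [c [Hc E]].
  destruct (tower_mvt F (S j) x c HF) as [d [_ E']].
  replace (F j y - F j x - F (S j) x * (y - x))
    with ((F (S j) c - F (S j) x) * (y - x)) by (rewrite E; ring).
  rewrite E', !Rabs_mult, <- pow2_abs.
  assert (Hcx : Rabs (c - x) <= Rabs (y - x)).
  { revert Hc; unfold Rmin, Rmax; destruct (Rle_dec x y); intros Hc.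
    - rewrite !Rabs_pos_eq; lra.
    - rewrite !Rabs_left1; lra. }
  pose proof (HK d); pose proof (Rabs_pos (F (S (S j)) d)).
  pose proof (Rabs_pos (c - x)).
  simpl; rewrite Rmult_1_r, <- Rmult_assoc.
  apply Rmult_le_compat_r; [apply Rabs_pos|].
  apply Rmult_le_compat; assumption.
Qed.

(** Second-order Taylor errors are summable, because the bounds on the
    derivative of order [j + 2] are; the sum therefore has a quadratic Taylor
    error as well, which gives its derivative. *)
Lemma tower_series (F : nat -> nat -> R -> R) (K : nat -> R) :
  (forall p, tower (F p)) ->
  (forall p j x, Rabs (F p j x) <= K j * (1 / 2) ^ p) ->
  tower (fun j x => Series (fun p => F p j x)).
Proof.
  intros HF HK j x.
  apply is_derive_of_quadratic_error with (2 * K (S (S j))); intros y.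
  assert (EX : forall i z, ex_series (fun p => F p i z)).
  { intros i z; now apply (series_geometric_bound _ (K i)). }
  rewrite <- Series_scal_r, <- !Series_minus by
    (try apply ex_series_scal_r; try apply (ex_series_minus (V := R_NormedModule)); apply EX).
  rewrite (Rmult_assoc 2).
  apply series_geometric_bound; intros p.
  eapply Rle_trans; [apply (tower_quadratic_error (F p) (K (S (S j)) * (1 / 2) ^ p)); auto|].
  apply Req_le; simpl; ring.
Qed.

Lemma Series_single (u : nat -> R) (n : nat) :
  (forall p, p <> n -> u p = 0) -> Series u = u n.
Proof.
  intros Hu; apply is_series_unique.
  apply (filterlim_ext_loc (fun _ => u n)); [|apply filterlim_const].
  exists n; intros m Hm; rewrite <- sumto_sum_n, (sumto_single u _ n Hu).
  destruct (le_lt_dec (S m) n); [lia|reflexivity].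
Qed.

(** The sum of [a p] times the localized monomials. Shrinking the supports by
    [eps] multiplies the [j]-th derivative of the [p]-th term by
    [eps ^ (p - j)]: the factor [eps ^ p] beats the geometric constants, and
    the loss [eps ^ (- j)] is harmless in the estimate. *)
Lemma borel_series (w t a : nat -> R) (tm B c : R) :
  (forall k, 0 < w k) -> (forall p, 0 < t p <= tm) ->
  (forall p n, sumto (fun k => w (p + k)%nat) n <= t p) -> 0 <= B -> 0 < c ->
  (forall p j, (j <= p)%nat ->
     Rabs (a p) <= B * c ^ p * ((INR p + 1) / t p) ^ (p - j) * prodto (fun k => / w k) j) ->
  exists F K H, tower F /\ 0 < H /\ (forall x, 1 < Rabs x -> F 0%nat x = 0) /\
    (forall n, F n 0 = a n) /\
    (forall j x, Rabs (F j x) <= K * H ^ j * prodto (fun k => / w k) j).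
Proof.
  intros Hw Ht Hs HB Hc Ha.
  set (W := prodto (fun k => / w k)) in *.
  assert (HW : forall j, 0 < W j).
  { intros j; apply prodto_pos; intros k; apply Rinv_0_lt_compat, Hw. }
  pose proof (exp_pos 8) as He8.
  assert (Htm : 0 < tm) by (destruct (Ht 0%nat); lra).
  (* [c e^8 eps <= 1/2] makes the series converge geometrically, and
     [8 eps tm <= 1] keeps all supports in [-1,1]. *)
  set (eps := / (2 * (c * exp 8) + 8 * tm)).
  assert (Hce : 0 < c * exp 8) by now apply Rmult_lt_0_compat.
  assert (Heps : 0 < eps) by (apply Rinv_0_lt_compat; lra).
  assert (Eeps : eps * (2 * (c * exp 8) + 8 * tm) = 1) by (unfold eps; field; lra).
  assert (Hq : c * exp 8 * eps <= 1 / 2) by nra.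
  destruct (choice (fun p F => tower F /\
    (forall n x, 8 * eps * t p < Rabs x -> F n x = 0) /\
    (forall n, F n 0 = if Nat.eq_dec n p then 1 else 0) /\
    (forall j x, (j <= p)%nat ->
       Rabs (F j x) <= 2 ^ j * (exp (8 * (INR p + 1)) * (eps * t p / (INR p + 1)) ^ (p - j))) /\
    (forall n x,
       Rabs (F (p + n)%nat x) <= 2 ^ (p + n) * (exp (8 * (INR p + 1)) *
         ((/ eps) ^ n * prodto (fun k => / w (p + k)%nat) n))))) as [F HF].
  { intros p; apply localized_monomial; auto; apply Ht. }
  assert (EE : forall p, exp (8 * (INR p + 1)) = exp 8 * exp 8 ^ p).
  { induction p as [|p IH].
    - simpl; rewrite Rplus_0_l, !Rmult_1_r; reflexivity.
    - rewrite S_INR; replace (8 * (INR p + 1 + 1)) with (8 * (INR p + 1) + 8) by ring.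
      rewrite exp_plus, IH; simpl; ring. }
  assert (HFB : forall p j x,
     Rabs (a p * F p j x) <= B * exp 8 * (2 / eps) ^ j * W j * (1 / 2) ^ p).
  { intros p j x; destruct (HF p) as [_ [_ [_ [F1 F2]]]].
    assert (HE : B * exp 8 * (c * exp 8 * eps) ^ p * ((2 / eps) ^ j * W j)
       <= B * exp 8 * (2 / eps) ^ j * W j * (1 / 2) ^ p).
    { replace (B * exp 8 * (2 / eps) ^ j * W j * (1 / 2) ^ p)
        with (B * exp 8 * (1 / 2) ^ p * ((2 / eps) ^ j * W j)) by ring.
      apply Rmult_le_compat_r.
      - apply Rmult_le_pos; [apply pow_le, Rlt_le, Rdiv_lt_0_compat; lra|apply Rlt_le, HW].
      - apply Rmult_le_compat_l; [apply Rmult_le_pos; lra|].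
        apply pow_incr; split; [|exact Hq]; apply Rmult_le_pos; lra. }
    eapply Rle_trans; [|exact HE]; clear HE.
    rewrite Rabs_mult; destruct (Ht p) as [Htp _]; pose proof (pos_INR p) as Hp.
    destruct (le_lt_dec j p) as [Hj|Hj].
    - eapply Rle_trans.
      { apply Rmult_le_compat; try apply Rabs_pos; [apply (Ha p j Hj)|apply (F1 j x Hj)]. }
      rewrite EE; apply Req_le.
      set (m := (p - j)%nat).
      assert (Em : eps ^ p = eps ^ m * eps ^ j).
      { rewrite <- pow_add; f_equal; unfold m; lia. }
      rewrite !Rpow_mult_distr, Em.
      unfold Rdiv; rewrite !Rpow_mult_distr.
      pose proof (Rinv_pow_mult eps j Heps) as I1.
      pose proof (Rinv_pow_mult (t p) m Htp) as I2.
      assert (I3 : (INR p + 1) ^ m * (/ (INR p + 1)) ^ m = 1).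
      { rewrite Rmult_comm; apply Rinv_pow_mult; lra. }
      transitivity (B * c ^ p * W j * 2 ^ j * exp 8 * exp 8 ^ p * eps ^ m
         * (((INR p + 1) ^ m * (/ (INR p + 1)) ^ m) * ((/ t p) ^ m * t p ^ m))); [ring|].
      rewrite I3, I2.
      transitivity (B * c ^ p * W j * 2 ^ j * exp 8 * exp 8 ^ p * eps ^ m
         * ((/ eps) ^ j * eps ^ j)); [rewrite I1; ring|ring].
    - set (n := (j - p)%nat); replace j with (p + n)%nat by (unfold n; lia).
      eapply Rle_trans.
      { apply Rmult_le_compat; try apply Rabs_pos; [apply (Ha p p (le_n p))|apply (F2 n x)]. }
      rewrite EE; apply Req_le.
      unfold W; rewrite prodto_add.
      set (W1 := prodto (fun k => / w k) p); set (W2 := prodto _ n).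
      rewrite Nat.sub_diag.
      pose proof (Rinv_pow_mult eps p Heps) as I1.
      unfold Rdiv; rewrite !Rpow_mult_distr, !pow_add.
      transitivity (B * c ^ p * W1 * W2 * (2 ^ p * 2 ^ n) * exp 8 * exp 8 ^ p * (/ eps) ^ n
         * ((/ eps) ^ p * eps ^ p)); [rewrite I1; simpl; ring|ring]. }
  exists (fun j x => Series (fun p => a p * F p j x)).
  exists (2 * (B * exp 8)), (2 / eps).
  split; [|split; [|split; [|split]]].
  - apply (tower_series (fun p j x => a p * F p j x) _) with (2 := HFB).
    intros p n x; apply (is_derive_scal (F p n)), HF.
  - apply Rdiv_lt_0_compat; lra.
  - intros x Hx.
    rewrite (Series_ext _ (fun _ => 0 * 0)); [rewrite Series_scal_l; ring|].
    intros p; destruct (HF p) as [_ [F0 _]]; rewrite F0; [ring|].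
    destruct (Ht p); nra.
  - intros n.
    rewrite (Series_single _ n).
    + destruct (HF n) as [_ [_ [F0 _]]]; rewrite F0; destruct (Nat.eq_dec n n); [ring|lia].
    + intros p Hp; destruct (HF p) as [_ [_ [F0 _]]]; rewrite F0.
      destruct (Nat.eq_dec n p); [lia|ring].
  - intros j x.
    destruct (series_geometric_bound _ _ (fun p => HFB p j x)) as [_ Hb].
    eapply Rle_trans; [exact Hb|]; apply Req_le; ring.
Qed.
(** * Roots, the relation [preceq] and factorial growth *)

Lemma root_gt0 (p : nat) (x : R) : 0 < root p x.
Proof. apply exp_pos. Qed.

Lemma root_pow (p : nat) (x : R) : (1 <= p)%nat -> 0 < x -> root p x ^ p = x.
Proof.
  intros Hp Hx; rewrite <- Rpower_pow by apply root_gt0.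
  unfold root; rewrite Rpower_mult, Rinv_l, Rpower_1; [reflexivity|exact Hx|].
  apply not_0_INR; lia.
Qed.

Lemma le_root (p : nat) (x y : R) : (1 <= p)%nat -> 0 < y -> y ^ p <= x -> y <= root p x.
Proof.
  intros Hp Hy Hx.
  assert (Hi : INR p <> 0) by (apply not_0_INR; lia).
  replace y with (root p (y ^ p)).
  2:{ unfold root; rewrite <- Rpower_pow, Rpower_mult, Rinv_r, Rpower_1 by assumption; reflexivity. }
  apply Rle_Rpower_l.
  - apply Rlt_le, Rinv_0_lt_compat, lt_0_INR; lia.
  - split; [now apply pow_lt|exact Hx].
Qed.

Lemma root_le (p : nat) (x y : R) : (1 <= p)%nat -> 0 < x -> 0 < y -> x <= y ^ p -> root p x <= y.
Proof.
  intros Hp Hx Hy H.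
  assert (Hi : INR p <> 0) by (apply not_0_INR; lia).
  replace y with (root p (y ^ p)).
  2:{ unfold root; rewrite <- Rpower_pow, Rpower_mult, Rinv_r, Rpower_1 by assumption; reflexivity. }
  apply Rle_Rpower_l.
  - apply Rlt_le, Rinv_0_lt_compat, lt_0_INR; lia.
  - split; assumption.
Qed.

Lemma preceq_iff (M N : nat -> R) : positive_seq M -> positive_seq N ->
  preceq M N <-> exists B, 1 <= B /\ forall j, (1 <= j)%nat -> M j <= B ^ j * N j.
Proof.
  intros HM HN; split; intros [B HB].
  - exists (Rmax 1 B); split; [apply Rmax_l|]; intros j Hj.
    assert (Hq : 0 < M j / N j) by (apply Rdiv_lt_0_compat; auto).
    replace (M j) with (M j / N j * N j) by (field; specialize (HN j); lra).
    apply Rmult_le_compat_r; [apply Rlt_le, HN|].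
    rewrite <- (root_pow j (M j / N j) Hj Hq).
    apply pow_incr; split; [apply Rlt_le, root_gt0|].
    eapply Rle_trans; [apply (HB j Hj)|apply Rmax_r].
  - destruct HB as [H1 HB]; exists B; intros j Hj.
    apply root_le; [exact Hj|apply Rdiv_lt_0_compat; auto|lra|].
    apply Rle_div_l; [apply HN|now apply HB].
Qed.

Lemma preceq_trans (M N P : nat -> R) :
  positive_seq M -> positive_seq N -> positive_seq P ->
  preceq M N -> preceq N P -> preceq M P.
Proof.
  intros HM HN HP H1 H2.
  apply preceq_iff in H1 as [B [B1 HB]]; try assumption.
  apply preceq_iff in H2 as [D [D1 HD]]; try assumption.
  apply preceq_iff; try assumption.
  exists (B * D); split; [nra|]; intros j Hj.
  rewrite Rpow_mult_distr, Rmult_assoc.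
  eapply Rle_trans; [apply HB, Hj|].
  apply Rmult_le_compat_l; [apply pow_le; lra|apply HD, Hj].
Qed.

Lemma lower_bound_extend (u v : nat -> R) (n0 : nat) (c : R) :
  (forall p, 0 < u p) -> (forall p, 0 < v p) -> 0 < c ->
  (forall p, (n0 <= p)%nat -> c * v p <= u p) ->
  exists c', 0 < c' /\ forall p, c' * v p <= u p.
Proof.
  intros Hu Hv; revert c; induction n0 as [|n IH]; intros c Hc H.
  - exists c; split; [exact Hc|]; intros p; apply H; lia.
  - apply (IH (Rmin c (u n / v n))).
    + apply Rmin_glb_lt; [exact Hc|apply Rdiv_lt_0_compat; auto].
    + intros p Hp; destruct (Nat.eq_dec p n) as [->|Hne].
      * apply Rle_trans with (u n / v n * v n).
        -- apply Rmult_le_compat_r; [apply Rlt_le, Hv|apply Rmin_r].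
        -- apply Req_le; field; specialize (Hv n); lra.
      * apply Rle_trans with (c * v p); [|apply H; lia].
        apply Rmult_le_compat_r; [apply Rlt_le, Hv|apply Rmin_l].
Qed.

(** For positive sequences this says that [(M_p / p!)^(1/p)] tends to infinity;
    the form without roots is the one that survives taking minima and
    log-convex minorants. *)
Definition outgrows_factorial (M : nat -> R) : Prop :=
  forall A, 0 < A -> exists c, 0 < c /\ forall p, c * (A ^ p * INR (fact p)) <= M p.

Lemma pow_unbounded (c : R) : 0 < c -> exists n0, forall n, (n0 <= n)%nat -> 1 <= c * 2 ^ n.
Proof.
  intros Hc.
  assert (H2 : is_lim_seq (fun n => 2 ^ n) p_infty) by (apply is_lim_seq_geom_p; lra).
  apply is_lim_seq_spec in H2; destruct (H2 (/ c)) as [n0 Hn0].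
  exists n0; intros n Hn; specialize (Hn0 n Hn).
  apply (Rmult_lt_compat_l c) in Hn0; [|exact Hc].
  rewrite Rinv_r in Hn0; lra.
Qed.

Lemma outgrows_factorial_root_lim (M d : nat -> R) :
  outgrows_factorial M -> (forall p, 0 < d p <= INR (fact p)) ->
  is_lim_seq (fun p => root p (M p / d p)) p_infty.
Proof.
  intros HM Hd; apply is_lim_seq_spec; intros b.
  pose proof (Rabs_pos b) as Hb.
  destruct (HM (2 * (Rabs b + 1))) as [c [Hc HcM]]; [lra|].
  destruct (pow_unbounded c Hc) as [n0 Hn0].
  exists (S n0); intros p Hp.
  apply Rlt_le_trans with (Rabs b + 1); [pose proof (Rle_abs b); lra|].
  apply le_root; [lia|lra|].
  apply Rle_div_r; [apply Hd|].
  eapply Rle_trans; [|apply HcM].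
  rewrite Rpow_mult_distr, <- !Rmult_assoc.
  assert (Hq : 0 <= (Rabs b + 1) ^ p) by (apply pow_le; lra).
  apply Rmult_le_compat; [exact Hq|apply Rlt_le, Hd| |apply Hd].
  rewrite <- (Rmult_1_l ((Rabs b + 1) ^ p)) at 1.
  apply Rmult_le_compat_r; [exact Hq|apply Hn0; lia].
Qed.
(** * The weight [N] and the sequence [Lseq] *)

Definition inv_nu (N : nat -> R) (k : nat) : R := / nu N (S k).

Lemma inv_nu_pos (N : nat -> R) : positive_seq N -> forall k, 0 < inv_nu N k.
Proof. intros HN k; apply Rinv_0_lt_compat, Rdiv_lt_0_compat; apply HN. Qed.

Lemma nu_pos (N : nat -> R) : positive_seq N -> forall k, 0 < nu N k.
Proof.
  intros HN [|k]; simpl; [lra|]; apply Rdiv_lt_0_compat; apply HN.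
Qed.

Lemma nu_incr (N : nat -> R) : positive_seq N -> log_convex N ->
  forall k l, (1 <= k <= l)%nat -> nu N k <= nu N l.
Proof.
  intros HN HL k l [Hk Hkl]; induction Hkl as [|l Hkl IH]; [lra|].
  eapply Rle_trans; [exact IH|].
  destruct l as [|l]; [lia|]; simpl.
  specialize (HL (S l) ltac:(lia)).
  replace (S l - 1)%nat with l in HL by lia.
  replace (S l + 1)%nat with (S (S l)) in HL by lia.
  pose proof (HN l); pose proof (HN (S l)).
  apply (Rmult_le_reg_r (N l)); [assumption|].
  apply (Rmult_le_reg_r (N (S l))); [assumption|].
  replace (N (S l) / N l * N l * N (S l)) with (N (S l) ^ 2) by (field; lra).
  replace (N (S (S l)) / N (S l) * N l * N (S l)) with (N l * N (S (S l))) by (field; lra).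
  exact HL.
Qed.

Lemma inv_nu_decr (N : nat -> R) : positive_seq N -> log_convex N ->
  forall k l, (k <= l)%nat -> inv_nu N l <= inv_nu N k.
Proof.
  intros HN HL k l Hkl; apply Rinv_le_contravar; [apply nu_pos, HN|].
  apply nu_incr; [exact HN|exact HL|lia].
Qed.

Lemma prodto_nu (N : nat -> R) : positive_seq N -> N 0%nat = 1 ->
  forall j, prodto (fun k => nu N (S k)) j = N j.
Proof.
  intros HN H0 j; induction j as [|j IH]; cbn [prodto]; [now rewrite H0|].
  rewrite IH; unfold nu; field; specialize (HN j); lra.
Qed.

Lemma ex_series_tail (f : nat -> R) (p : nat) : ex_series f -> ex_series (fun k => f (p + k)%nat).
Proof. intros Hf; now apply (ex_series_incr_n (V := R_NormedModule)). Qed.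

Lemma sumto_le_series (f : nat -> R) (n : nat) :
  (forall k, 0 <= f k) -> ex_series f -> sumto f n <= Series f.
Proof.
  intros Hp Hf; destruct n as [|n].
  - simpl; rewrite <- (Rmult_0_l (Series f)), <- Series_scal_l.
    apply Series_le; [|exact Hf]; intros k; specialize (Hp k); lra.
  - rewrite (Series_incr_n f (S n)) by (lia || exact Hf); simpl Init.Nat.pred.
    rewrite sumto_sum_n, sum_n_Reals.
    rewrite <- (Rplus_0_r (sum_f_R0 f n)) at 1; apply Rplus_le_compat_l.
    rewrite <- (Rmult_0_l (Series (fun k => f (S n + k)%nat))), <- Series_scal_l.
    apply Series_le; [|apply (ex_series_tail f (S n)), Hf].
    intros k; specialize (Hp (S n + k)%nat); lra.
Qed.

Lemma tail_sum_S (N : nat -> R) (p : nat) :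
  tail_sum N (S p) = Series (fun k => inv_nu N (p + k)).
Proof. reflexivity. Qed.

Lemma tail_sum_step (N : nat -> R) (p : nat) : nonquasianalytic N ->
  tail_sum N (S p) = inv_nu N p + tail_sum N (S (S p)).
Proof.
  intros Hq; rewrite !tail_sum_S, Series_incr_1 by (now apply (ex_series_tail (inv_nu N))).
  rewrite Nat.add_0_r; f_equal; apply Series_ext; intros k; f_equal; lia.
Qed.

Lemma sumto_le_tail_sum (N : nat -> R) (p n : nat) :
  positive_seq N -> nonquasianalytic N ->
  sumto (fun k => inv_nu N (p + k)) n <= tail_sum N (S p).
Proof.
  intros HN Hq; apply sumto_le_series.
  - intros k; apply Rlt_le, inv_nu_pos, HN.
  - now apply (ex_series_tail (inv_nu N)).
Qed.

Lemma tail_sum_split (N : nat -> R) (p n : nat) : nonquasianalytic N ->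
  tail_sum N (S p) = sumto (fun k => inv_nu N (p + k)) n + tail_sum N (S (p + n)).
Proof.
  intros Hq; induction n as [|n IH]; simpl; [rewrite Nat.add_0_r; ring|].
  rewrite IH, tail_sum_step by exact Hq; rewrite Nat.add_succ_r; ring.
Qed.

Lemma tail_sum_pos (N : nat -> R) (p : nat) :
  positive_seq N -> nonquasianalytic N -> 0 < tail_sum N (S p).
Proof.
  intros HN Hq; eapply Rlt_le_trans; [|apply (sumto_le_tail_sum N p 1 HN Hq)].
  simpl; rewrite Rplus_0_l; apply inv_nu_pos, HN.
Qed.

Lemma tail_sum_decr (N : nat -> R) : positive_seq N -> nonquasianalytic N ->
  forall p q, (p <= q)%nat -> tail_sum N (S q) <= tail_sum N (S p).
Proof.
  intros HN Hq p q Hpq; replace q with (p + (q - p))%nat by lia.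
  rewrite (tail_sum_split N p (q - p) Hq).
  pose proof (sumto_nonneg (fun k => inv_nu N (p + k)) (q - p)
                (fun k => Rlt_le _ _ (inv_nu_pos N HN _))); lra.
Qed.

Lemma tail_sum_small (N : nat -> R) : positive_seq N -> nonquasianalytic N ->
  forall e, 0 < e -> exists n0, forall n, (n0 <= n)%nat -> tail_sum N (S n) < e.
Proof.
  intros HN Hq e He.
  assert (H : is_lim_seq (sum_n (inv_nu N)) (Series (inv_nu N))).
  { apply (Series_correct (inv_nu N)), Hq. }
  apply is_lim_seq_spec in H; destruct (H (mkposreal _ He)) as [n0 Hn0]; simpl in Hn0.
  exists (S n0); intros n Hn; destruct n as [|n]; [lia|].
  specialize (Hn0 n ltac:(lia)).
  rewrite <- sumto_sum_n in Hn0.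
  pose proof (tail_sum_split N 0 (S n) Hq) as E; rewrite tail_sum_S in E; simpl Nat.add in E.
  change (Series (fun k => inv_nu N k)) with (Series (inv_nu N)) in E.
  change (fun k => inv_nu N k) with (inv_nu N) in E.
  apply Rabs_lt_between in Hn0; lra.
Qed.

(** A decreasing summable sequence is [o(1/k)]. *)
Lemma nu_superlinear (N : nat -> R) :
  positive_seq N -> log_convex N -> nonquasianalytic N ->
  forall A, 0 < A -> exists k0, forall k, (k0 <= k)%nat -> A * (INR k + 1) <= nu N (S k).
Proof.
  intros HN HL Hq A HA.
  destruct (tail_sum_small N HN Hq (/ (2 * A))) as [m Hm].
  { apply Rinv_0_lt_compat; lra. }
  specialize (Hm m (le_n m)).
  exists (2 * m)%nat; intros k Hk.
  pose proof (nu_pos N HN (S k)) as Hnu.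
  (* the terms with index in [m, k] are at least [1 / nu_(k+1)] *)
  assert (H : INR (S (k - m)) * inv_nu N k <= / (2 * A)).
  { apply Rle_trans with (sumto (fun i => inv_nu N (m + i)) (S (k - m))).
    - apply sumto_const_le; intros i Hi; apply inv_nu_decr; [exact HN|exact HL|lia].
    - apply Rlt_le; eapply Rle_lt_trans; [now apply sumto_le_tail_sum|exact Hm]. }
  unfold inv_nu in H.
  apply (Rmult_le_compat_r (nu N (S k))) in H; [|lra].
  rewrite Rmult_assoc, Rinv_l, Rmult_1_r in H by lra.
  apply (Rmult_le_compat_l (2 * A)) in H; [|lra].
  rewrite <- Rmult_assoc, Rinv_r, Rmult_1_l in H by lra.
  assert (Hi : INR k + 1 <= 2 * INR (S (k - m))).
  { rewrite <- S_INR; change 2 with (INR 2); rewrite <- mult_INR; apply le_INR; lia. }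
  nra.
Qed.

Lemma weight_outgrows_factorial (N : nat -> R) :
  positive_seq N -> log_convex N -> nonquasianalytic N -> outgrows_factorial N.
Proof.
  intros HN HL Hq A HA.
  destruct (nu_superlinear N HN HL Hq A HA) as [k0 Hk0].
  assert (Hv : forall p, 0 < A ^ p * INR (fact p)).
  { intros p; apply Rmult_lt_0_compat; [now apply pow_lt|apply INR_fact_lt_0]. }
  apply (lower_bound_extend N (fun p => A ^ p * INR (fact p)) k0
           (N k0 / (A ^ k0 * INR (fact k0)))); [exact HN|exact Hv|now apply Rdiv_lt_0_compat|].
  intros p Hp; induction Hp as [|p Hp IH].
  - apply Req_le; field; split; [apply INR_fact_neq_0|apply pow_nonzero; lra].
  - specialize (Hk0 p Hp); simpl nu in Hk0.
    pose proof (HN p).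
    replace (N (S p)) with (N (S p) / N p * N p) by (field; lra).
    set (c := N k0 / (A ^ k0 * INR (fact k0))) in *.
    replace (c * (A ^ S p * INR (fact (S p))))
      with (A * (INR p + 1) * (c * (A ^ p * INR (fact p))))
      by (rewrite fact_simpl, mult_INR, S_INR; simpl; ring).
    apply Rmult_le_compat; [|..|exact Hk0|exact IH].
    + pose proof (pos_INR p); nra.
    + apply Rmult_le_pos; [apply Rlt_le, Rdiv_lt_0_compat; auto|apply Rlt_le, Hv].
Qed.

Lemma MinRlist_ge (l : list R) (x : R) : l <> nil ->
  (forall y, In y l -> x <= y) -> x <= MinRlist l.
Proof.
  induction l as [|a l IH]; intros Hl H; [congruence|].
  destruct l as [|b l]; [apply H; now left|].
  change (x <= Rmin a (MinRlist (b :: l))); apply Rmin_glb; [apply H; now left|].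
  apply IH; [discriminate|]; intros y Hy; apply H; now right.
Qed.

Lemma Lseq_le (N : nat -> R) (s p j : nat) : (j < p)%nat ->
  Lseq N s p <= INR s ^ p * ((INR p / tail_sum N p) ^ (p - j) * N j).
Proof.
  intros Hj; destruct p as [|p]; [lia|].
  apply Rmult_le_compat_l; [apply pow_le, pos_INR|].
  apply MinRlist_P1, in_map_iff; exists j; split; [reflexivity|].
  apply in_seq; lia.
Qed.

Lemma Lseq_ge (N : nat -> R) (s p : nat) (x : R) : (1 <= p)%nat ->
  (forall j, (j < p)%nat -> x <= (INR p / tail_sum N p) ^ (p - j) * N j) ->
  INR s ^ p * x <= Lseq N s p.
Proof.
  intros Hp H; destruct p as [|p]; [lia|].
  apply Rmult_le_compat_l; [apply pow_le, pos_INR|].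
  apply MinRlist_ge; [discriminate|].
  intros y Hy; apply in_map_iff in Hy; destruct Hy as [j [<- Hj]].
  apply in_seq in Hj; apply H; lia.
Qed.

Lemma fact_le_pow (j m : nat) : INR (fact (j + m)) <= INR (j + m) ^ m * INR (fact j).
Proof.
  induction m as [|m IH]; [rewrite Nat.add_0_r; simpl; lra|].
  rewrite Nat.add_succ_r, fact_simpl, mult_INR, <- tech_pow_Rmult, Rmult_assoc.
  apply Rmult_le_compat_l; [apply pos_INR|].
  eapply Rle_trans; [exact IH|].
  apply Rmult_le_compat_r; [apply pos_INR|].
  apply pow_incr; split; [apply pos_INR|apply le_INR; lia].
Qed.

Lemma Lseq_pos (N : nat -> R) (s : nat) : (1 <= s)%nat ->
  positive_seq N -> nonquasianalytic N -> positive_seq (Lseq N s).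
Proof.
  intros Hs HN Hq [|p]; [simpl; lra|].
  apply Rmult_lt_0_compat; [apply pow_lt, lt_0_INR; lia|].
  apply MinRlist_P2; intros y Hy; apply in_map_iff in Hy; destruct Hy as [j [<- _]].
  apply Rmult_lt_0_compat; [|apply HN].
  apply pow_lt, Rdiv_lt_0_compat; [apply lt_0_INR; lia|now apply tail_sum_pos].
Qed.

(** Since [p! <= p ^ (p - j) * j!] and the tail sums are eventually below [/ A],
    each term of the minimum inherits the bound [c * A ^ j * j!] of [N j]. *)
Lemma Lseq_outgrows_factorial (N : nat -> R) (s : nat) : (1 <= s)%nat ->
  positive_seq N -> log_convex N -> nonquasianalytic N ->
  outgrows_factorial (Lseq N s).
Proof.
  intros Hs HN HL Hq A HA.
  destruct (weight_outgrows_factorial N HN HL Hq A HA) as [c [Hc HcN]].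
  destruct (tail_sum_small N HN Hq (/ A) (Rinv_0_lt_compat A HA)) as [n0 Hn0].
  assert (Hs1 : 1 <= INR s) by (apply (le_INR 1), Hs).
  apply (lower_bound_extend (Lseq N s) (fun p => A ^ p * INR (fact p)) (S n0) c).
  - now apply Lseq_pos.
  - intros p; apply Rmult_lt_0_compat; [now apply pow_lt|apply INR_fact_lt_0].
  - exact Hc.
  - intros p Hp; destruct p as [|p]; [lia|].
    eapply Rle_trans; [|apply (Lseq_ge N s (S p) (c * (A ^ S p * INR (fact (S p)))))].
    + assert (H1 : 1 <= INR s ^ S p) by (apply pow_R1_Rle, Hs1).
      assert (H2 : 0 <= c * (A ^ S p * INR (fact (S p)))).
      { apply Rmult_le_pos; [lra|apply Rmult_le_pos; [apply pow_le; lra|apply pos_INR]]. }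
      nra.
    + lia.
    + intros j Hj; specialize (Hn0 p ltac:(lia)).
      pose proof (tail_sum_pos N p HN Hq) as Ht.
      set (m := (S p - j)%nat).
      assert (Ej : S p = (j + m)%nat) by (unfold m; lia).
      apply Rle_trans with ((INR (S p) * A) ^ m * (c * (A ^ j * INR (fact j)))).
      * rewrite Rpow_mult_distr.
        pose proof (fact_le_pow j m) as Hf; rewrite <- Ej in Hf.
        replace (INR (S p) ^ m * A ^ m * (c * (A ^ j * INR (fact j))))
          with (c * (A ^ (j + m) * (INR (S p) ^ m * INR (fact j)))) by (rewrite pow_add; ring).
        rewrite <- Ej; apply Rmult_le_compat_l; [lra|].
        apply Rmult_le_compat_l; [apply pow_le; lra|exact Hf].
      * apply Rmult_le_compat; [apply pow_le, Rmult_le_pos; [apply pos_INR|lra]| |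
                                |apply HcN].
        -- apply Rmult_le_pos; [lra|apply Rmult_le_pos; [apply pow_le; lra|apply pos_INR]].
        -- apply pow_incr; split; [apply Rmult_le_pos; [apply pos_INR|lra]|].
           apply Rmult_le_compat_l; [apply pos_INR|].
           rewrite <- (Rinv_inv A); apply Rinv_le_contravar; lra.
Qed.

Lemma Lseq_le_weight (N : nat -> R) (s p : nat) : (1 <= s)%nat -> (1 <= p)%nat ->
  positive_seq N -> nonquasianalytic N -> Lseq N s p <= (INR s * 2) ^ p * N p.
Proof.
  intros Hs Hp HN Hq.
  assert (Hs1 : 1 <= INR s) by (apply (le_INR 1), Hs).
  destruct p as [|p]; [lia|].
  eapply Rle_trans; [apply (Lseq_le N s (S p) p); lia|].
  replace (S p - p)%nat with 1%nat by lia.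
  rewrite pow_1, Rpow_mult_distr, Rmult_assoc.
  apply Rmult_le_compat_l; [apply pow_le; lra|].
  assert (H1 : INR (S p) <= 2 ^ S p).
  { clear; induction (S p) as [|n IH]; [simpl; lra|].
    rewrite S_INR; simpl.
    assert (1 <= 2 ^ n) by (apply pow_R1_Rle; lra); lra. }
  assert (H2 : / tail_sum N (S p) <= N (S p) / N p).
  { rewrite <- (Rinv_inv (N (S p) / N p)); apply Rinv_le_contravar.
    - apply (inv_nu_pos N HN p).
    - pose proof (sumto_le_tail_sum N p 1 HN Hq) as H; simpl in H.
      rewrite Rplus_0_l, Nat.add_0_r in H; exact H. }
  pose proof (tail_sum_pos N p HN Hq) as Ht; pose proof (HN p) as HNp.
  replace (N (S p)) with (N (S p) / N p * N p) by (field; lra).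
  unfold Rdiv at 1; rewrite !Rmult_assoc.
  apply Rmult_le_compat; [apply pos_INR| |exact H1|].
  - apply Rmult_le_pos; [apply Rlt_le, Rinv_0_lt_compat, Ht|lra].
  - apply Rmult_le_compat_r; [lra|exact H2].
Qed.

Lemma Lseq_preceq (N : nat -> R) (s : nat) : (1 <= s)%nat ->
  positive_seq N -> nonquasianalytic N -> preceq (Lseq N s) N.
Proof.
  intros Hs HN Hq; apply preceq_iff; [now apply Lseq_pos|exact HN|].
  assert (Hs1 : 1 <= INR s) by (apply (le_INR 1), Hs).
  exists (INR s * 2); split; [lra|]; intros p Hp; now apply Lseq_le_weight.
Qed.

Lemma Lseq_N_B (N : nat -> R) (s : nat) : (1 <= s)%nat ->
  LC N -> nonquasianalytic N -> N_B N (Lseq N s).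
Proof.
  intros Hs [HN [_ [_ [HL _]]]] Hq; split; [now apply Lseq_pos|split].
  - apply (outgrows_factorial_root_lim _ (fun p => INR (fact p))).
    + now apply Lseq_outgrows_factorial.
    + intros p; split; [apply INR_fact_lt_0|lra].
  - now apply Lseq_preceq.
Qed.

Lemma N_B_N_R (N M : nat -> R) : N_B N M -> N_R N M.
Proof.
  intros [HM [Hl Hp]]; split; [exact HM|split; [|exact Hp]].
  rewrite (is_LimInf_seq_unique _ p_infty); [exact I|now apply is_lim_LimInf_seq].
Qed.

(** * Surjectivity of the Borel map *)

Lemma Cmod_le_sum (z : C) : Cmod z <= Rabs (Re z) + Rabs (Im z).
Proof.
  destruct z as [x y]; unfold Cmod, Re, Im; simpl fst; simpl snd.
  pose proof (Rabs_pos x); pose proof (Rabs_pos y).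
  rewrite <- (sqrt_pow2 (Rabs x + Rabs y)) by lra.
  apply sqrt_le_1_alt; rewrite <- (pow2_abs x), <- (pow2_abs y); nra.
Qed.

Lemma supp_in_interval (f : R -> C) :
  (forall x, 1 < Rabs x -> f x = RtoC 0) -> included (supp f) (fun x => -1 <= x <= 1).
Proof.
  intros Hf x Hx; apply Rabs_le_between, Rnot_lt_le; intros H1.
  destruct (locally_Rabs_gt 1 x H1) as [d Hd].
  destruct (Hx (fun y => 1 < Rabs y)) as [y [Hy Hne]]; [|exact (Hne (Hf y Hy))].
  exists d; exact Hd.
Qed.

Lemma borel_series_complex (w t : nat -> R) (a : nat -> C) (tm B c : R) :
  (forall k, 0 < w k) -> (forall p, 0 < t p <= tm) ->
  (forall p n, sumto (fun k => w (p + k)%nat) n <= t p) -> 0 <= B -> 0 < c ->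
  (forall p j, (j <= p)%nat ->
     Cmod (a p) <= B * c ^ p * ((INR p + 1) / t p) ^ (p - j) * prodto (fun k => / w k) j) ->
  exists (f : R -> C) K H, 0 < H /\ smooth f /\
    included (supp f) (fun x => -1 <= x <= 1) /\ (forall p, Borel f p = a p) /\
    (forall p x, Cmod (CDerive_n f p x) <= K * H ^ p * prodto (fun k => / w k) p).
Proof.
  intros Hw Ht Hs HB Hc Ha.
  destruct (borel_series w t (fun p => Re (a p)) tm B c) as [F1 [K1 [H1 [T1 [P1 [S1 [V1 B1]]]]]]];
    try assumption.
  { intros p j Hj; eapply Rle_trans; [|now apply Ha].
    eapply Rle_trans; [apply Rmax_l|apply Rmax_Cmod]. }
  destruct (borel_series w t (fun p => Im (a p)) tm B c) as [F2 [K2 [H2 [T2 [P2 [S2 [V2 B2]]]]]]];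
    try assumption.
  { intros p j Hj; eapply Rle_trans; [|now apply Ha].
    eapply Rle_trans; [apply Rmax_r|apply Rmax_Cmod]. }
  pose (f := fun x => (F1 0%nat x, F2 0%nat x) : C).
  assert (D : forall n x, CDerive_n f n x = (F1 n x, F2 n x)).
  { intros n x; unfold CDerive_n; f_equal.
    - exact (tower_Derive_n F1 T1 n x).
    - exact (tower_Derive_n F2 T2 n x). }
  exists f, (Rabs K1 + Rabs K2), (H1 + H2); split; [lra|split; [|split; [|split]]].
  - intros n x; split; [exact (tower_ex_derive_n F1 T1 n x)|exact (tower_ex_derive_n F2 T2 n x)].
  - apply supp_in_interval; intros x Hx; unfold f; now rewrite S1, S2.
  - intros p; unfold Borel; rewrite D, V1, V2; now destruct (a p).
  - intros p x; rewrite D; eapply Rle_trans; [apply Cmod_le_sum|]; simpl.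
    assert (HW : 0 < prodto (fun k => / w k) p).
    { apply prodto_pos; intros k; apply Rinv_0_lt_compat, Hw. }
    assert (E : forall K H, 0 < H <= H1 + H2 ->
       K * H ^ p * prodto (fun k => / w k) p
       <= Rabs K * (H1 + H2) ^ p * prodto (fun k => / w k) p).
    { intros K H HH; apply Rmult_le_compat_r; [lra|].
      assert (0 < H ^ p) by now apply pow_lt.
      assert (H ^ p <= (H1 + H2) ^ p) by (apply pow_incr; lra).
      pose proof (Rle_abs K); pose proof (Rabs_pos K); nra. }
    specialize (B1 p x); specialize (B2 p x).
    pose proof (E K1 H1 ltac:(lra)); pose proof (E K2 H2 ltac:(lra)); lra.
Qed.

(** The bound also covers [j = p], by [Lseq_le_weight], and [p = 0], by replacing [p] with
    [p + 1] in the numerator and starting the tail at [pred p]. *)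
Lemma Lseq_bound (N : nat -> R) (s p j : nat) : (1 <= s)%nat ->
  positive_seq N -> N 0%nat = 1 -> nonquasianalytic N -> (j <= p)%nat ->
  Lseq N s p <= (2 * INR s) ^ p * (((INR p + 1) / tail_sum N (S (pred p))) ^ (p - j) * N j).
Proof.
  intros Hs HN H0 Hq Hj.
  assert (Hs1 : 1 <= INR s) by (apply (le_INR 1), Hs).
  destruct p as [|p].
  { replace j with 0%nat by lia; simpl; rewrite H0; lra. }
  simpl pred; pose proof (tail_sum_pos N p HN Hq) as Ht.
  assert (Hjp : Lseq N s (S p) <= INR s ^ S p * ((INR (S p) / tail_sum N (S p)) ^ (S p - j) * N j)
              \/ j = S p) by (destruct (Nat.eq_dec j (S p)); [now right|left; apply Lseq_le; lia]).
  destruct Hjp as [H| ->].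
  - eapply Rle_trans; [exact H|].
    apply Rmult_le_compat; [apply pow_le; lra| |apply pow_incr; lra|].
    + apply Rmult_le_pos; [|apply Rlt_le, HN].
      apply pow_le, Rlt_le, Rdiv_lt_0_compat; [apply lt_0_INR; lia|exact Ht].
    + apply Rmult_le_compat_r; [apply Rlt_le, HN|].
      apply pow_incr; split.
      * apply Rlt_le, Rdiv_lt_0_compat; [apply lt_0_INR; lia|exact Ht].
      * apply Rmult_le_compat_r; [apply Rlt_le, Rinv_0_lt_compat, Ht|lra].
  - rewrite Nat.sub_diag, pow_O, Rmult_1_l.
    rewrite (Rmult_comm 2); apply Lseq_le_weight; auto; lia.
Qed.

Lemma Lambda_h_bound (M : nat -> R) (h : R) (a : nat -> C) :
  positive_seq M -> 0 < h -> Lambda_h M h a ->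
  exists B, 0 <= B /\ forall p, Cmod (a p) <= B * (h ^ p * M p).
Proof.
  intros HM Hh [B HB]; exists (Rabs B); split; [apply Rabs_pos|]; intros p.
  assert (Hp : 0 < h ^ p * M p) by (apply Rmult_lt_0_compat; [now apply pow_lt|apply HM]).
  specialize (HB p); apply Rle_div_l in HB; [|exact Hp].
  eapply Rle_trans; [exact HB|]; apply Rmult_le_compat_r; [lra|apply Rle_abs].
Qed.

Lemma Borel_image_R_Lseq (N : nat -> R) (s : nat) : (1 <= s)%nat ->
  LC N -> nonquasianalytic N -> Borel_image_R N (Lseq N s).
Proof.
  intros Hs [HN [H0 [_ [HL _]]]] Hq a [h [Hh Ha]].
  pose proof (Lseq_pos N s Hs HN Hq) as HLp.
  apply Lambda_h_bound in Ha as [B [HB Ha]]; [|exact HLp|exact Hh].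
  assert (Hs1 : 1 <= INR s) by (apply (le_INR 1), Hs).
  assert (EW : forall j, prodto (fun k => / inv_nu N k) j = N j).
  { intros j; rewrite <- (prodto_nu N HN H0 j); apply prodto_ext.
    intros k _; apply Rinv_inv. }
  destruct (borel_series_complex (inv_nu N) (fun p => tail_sum N (S (pred p))) a
              (tail_sum N 1) B (h * (2 * INR s))) as [f [K [H [HH [Sf [Sup [Vf Bf]]]]]]].
  - now apply inv_nu_pos.
  - intros p; split; [now apply tail_sum_pos|apply tail_sum_decr; auto; lia].
  - intros p n; eapply Rle_trans; [now apply sumto_le_tail_sum|].
    apply tail_sum_decr; auto; lia.
  - exact HB.
  - apply Rmult_lt_0_compat; lra.
  - intros p j Hj; rewrite EW.
    eapply Rle_trans; [apply Ha|].
    rewrite (Rpow_mult_distr h), !Rmult_assoc; apply Rmult_le_compat_l; [exact HB|].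
    apply Rmult_le_compat_l; [apply pow_le; lra|].
    now apply Lseq_bound.
  - exists f; split; [|exact Vf].
    exists H; split; [exact HH|]; split; [exact Sf|split; [exact Sup|]].
    exists K; intros p x.
    apply Rle_div_l; [apply Rmult_lt_0_compat; [now apply pow_lt|apply HN]|].
    specialize (Bf p x); rewrite EW in Bf; lra.
Qed.

(** A sequence below every geometric rate is also below some rate [g p] that
    tends to infinity. Halving the supremum avoids asking whether it is
    attained. *)
Lemma bounded_root_weight (b : nat -> R) :
  (forall p, 0 <= b p) ->
  (forall h, 0 < h -> exists B, forall p, b p <= B * h ^ p) ->
  exists g B, 0 <= B /\ (forall p, 0 < g p) /\ (forall p, g p <= g (S p)) /\
    (forall r, exists p, r <= g p) /\ (forall p, b p * g p ^ p <= B).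
Proof.
  intros Hb HB.
  destruct (HB 1 Rlt_0_1) as [B0 HB0].
  set (B := Rabs B0 + 1).
  assert (HBp : 1 <= B) by (pose proof (Rabs_pos B0); unfold B; lra).
  pose (E := fun p y => 0 <= y <= INR p + 1 /\ forall q, (p <= q)%nat -> b q * y ^ q <= B).
  assert (E1 : forall p, E p 1).
  { intros p; pose proof (pos_INR p); split; [lra|]; intros q _.
    specialize (HB0 q); rewrite pow1 in *; pose proof (Rle_abs B0); unfold B; lra. }
  destruct (choice (fun p m => is_lub (E p) m)) as [m Hm].
  { intros p; destruct (completeness (E p)) as [m Hm].
    - exists (INR p + 1); intros y Hy; apply Hy.
    - exists 1; apply E1.
    - now exists m. }
  assert (Hm1 : forall p, 1 <= m p) by (intros p; apply (proj1 (Hm p)), E1).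
  exists (fun p => m p / 2), B; split; [lra|split; [|split; [|split]]].
  - intros p; specialize (Hm1 p); lra.
  - intros p; apply Rmult_le_compat_r; [lra|].
    apply (proj2 (Hm p)); intros y [Hy Hq]; apply (proj1 (Hm (S p))).
    split; [rewrite S_INR; lra|intros q Hpq; apply Hq; lia].
  - intros r; pose proof (Rabs_pos r) as Hr.
    set (y := 2 * (Rabs r + 1)).
    destruct (HB (/ (2 * y))) as [B1 HB1]; [apply Rinv_0_lt_compat; unfold y; lra|].
    destruct (pow_unbounded (/ (Rabs B1 + 1))) as [n0 Hn0].
    { apply Rinv_0_lt_compat; pose proof (Rabs_pos B1); lra. }
    destruct (INR_unbounded y) as [n1 Hn1].
    exists (Nat.max n0 n1).
    apply Rle_trans with (y / 2); [unfold y; pose proof (Rle_abs r); lra|].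
    apply Rmult_le_compat_r; [lra|].
    apply (proj1 (Hm _)); split.
    + split; [unfold y; lra|].
      apply Rle_trans with (INR n1); [lra|].
      apply Rle_trans with (INR (Nat.max n0 n1)); [apply le_INR; lia|lra].
    + intros q Hq; specialize (HB1 q); specialize (Hn0 q ltac:(lia)).
      apply Rle_trans with 1; [|exact HBp].
      assert (Hy : 0 < y) by (unfold y; lra).
      apply Rle_trans with ((Rabs B1 + 1) * / 2 ^ q).
      * apply (Rmult_le_compat_r (y ^ q)) in HB1; [|apply pow_le; lra].
        eapply Rle_trans; [exact HB1|].
        rewrite Rinv_mult, Rpow_mult_distr, Rmult_assoc, Rmult_assoc, Rinv_pow_mult, Rmult_1_r, pow_inv
          by exact Hy.
        apply Rmult_le_compat_r; [apply Rlt_le, Rinv_0_lt_compat, pow_lt; lra|].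
        pose proof (Rle_abs B1); lra.
      * pose proof (Rabs_pos B1).
        apply (Rmult_le_reg_r (2 ^ q)); [apply pow_lt; lra|].
        rewrite Rmult_assoc, Rinv_l, Rmult_1_r, Rmult_1_l by (apply pow_nonzero; lra).
        apply (Rmult_le_compat_l (Rabs B1 + 1)) in Hn0; [|lra].
        rewrite <- Rmult_assoc, Rinv_r in Hn0 by lra; lra.
  - intros p; specialize (Hm1 p).
    assert (Hy : exists y, E p y /\ m p / 2 <= y).
    { apply NNPP; intros Hn.
      assert (m p <= m p / 2); [|lra].
      apply (proj2 (Hm p)); intros y Hy; apply Rnot_lt_le; intros Hlt.
      apply Hn; exists y; split; [exact Hy|lra]. }
    destruct Hy as [y [[_ Hy] Hmy]].
    eapply Rle_trans; [|apply (Hy p (le_n p))].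
    apply Rmult_le_compat_l; [apply Hb|apply pow_incr; lra].
Qed.

(** The largest sequence below [g] whose product with [sg] does not increase. *)
Fixpoint throttle (g sg : nat -> R) (k : nat) : R :=
  match k with
  | O => g 0%nat
  | S k' => Rmin (g (S k')) (throttle g sg k' * sg k' / sg (S k'))
  end.

Lemma throttle_spec (g sg : nat -> R) :
  (forall p, 0 < g p) -> (forall p, g p <= g (S p)) -> (forall r, exists p, r <= g p) ->
  (forall p, 0 < sg p) -> (forall p, sg (S p) <= sg p) ->
  (forall e, 0 < e -> exists p, forall q, (p <= q)%nat -> sg q < e) ->
  (forall p, 0 < throttle g sg p) /\ (forall p, throttle g sg p <= g p) /\
  (forall p, throttle g sg p <= throttle g sg (S p)) /\
  (forall p, throttle g sg (S p) * sg (S p) <= throttle g sg p * sg p) /\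
  (forall r, exists p, r <= throttle g sg p).
Proof.
  intros Hg Gi Gu Hs Si Su; set (A := throttle g sg).
  assert (P : forall p, 0 < A p).
  { induction p as [|p IH]; simpl; [apply Hg|].
    apply Rmin_glb_lt; [apply Hg|].
    apply Rdiv_lt_0_compat; [now apply Rmult_lt_0_compat|apply Hs]. }
  assert (L : forall p, A p <= g p) by (intros [|p]; [apply Rle_refl|apply Rmin_l]).
  assert (X : forall p, A p * sg p / sg (S p) * sg (S p) = A p * sg p).
  { intros p; field; specialize (Hs (S p)); lra. }
  split; [exact P|split; [exact L|split; [|split]]].
  - intros p; simpl; apply Rmin_glb; [eapply Rle_trans; [apply L|apply Gi]|].
    apply Rle_div_r; [apply Hs|]; apply Rmult_le_compat_l; [apply Rlt_le, P|apply Si].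
  - intros p; rewrite <- (X p); apply Rmult_le_compat_r; [apply Rlt_le, Hs|apply Rmin_r].
  - intros r; apply NNPP; intros Hn.
    assert (HA : forall p, A p < r) by (intros p; apply Rnot_le_lt; intros H; apply Hn; now exists p).
    destruct (Gu r) as [k0 Hk0].
    (* once [g] exceeds [r], the product [A * sg] stays constant *)
    assert (Ek : forall k, A (k0 + k)%nat * sg (k0 + k)%nat = A k0 * sg k0).
    { induction k as [|k IH]; [now rewrite Nat.add_0_r|].
      rewrite <- IH, Nat.add_succ_r, <- (X (k0 + k)%nat); f_equal.
      change (A (S (k0 + k))) with
        (Rmin (g (S (k0 + k))) (A (k0 + k)%nat * sg (k0 + k)%nat / sg (S (k0 + k)))).
      apply Rmin_right, Rnot_lt_le; intros Hlt.
      specialize (HA (S (k0 + k))).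
      change (A (S (k0 + k))) with
        (Rmin (g (S (k0 + k))) (A (k0 + k)%nat * sg (k0 + k)%nat / sg (S (k0 + k)))) in HA.
      rewrite Rmin_left in HA by lra.
      pose proof (incr_steps g Gi k0 (S (k0 + k)) ltac:(lia)); lra. }
    assert (Hr : 0 < r) by (specialize (HA 0%nat); specialize (P 0%nat); lra).
    destruct (Su (A k0 * sg k0 / r)) as [k1 Hk1].
    { apply Rdiv_lt_0_compat; [now apply Rmult_lt_0_compat|exact Hr]. }
    specialize (Hk1 (k0 + k1)%nat ltac:(lia)).
    specialize (HA (k0 + k1)%nat); specialize (Ek k1); specialize (Hs (k0 + k1)%nat).
    apply (Rmult_lt_compat_r r) in Hk1; [|exact Hr].
    replace (A k0 * sg k0 / r * r) with (A k0 * sg k0) in Hk1 by (field; lra).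
    nra.
Qed.

Lemma pow_le_prodto (A : nat -> R) :
  (forall p, 0 < A p) -> (forall p, A p <= A (S p)) -> (forall r, exists p, r <= A p) ->
  forall r, 0 < r -> exists c, 0 < c /\ forall j, c * r ^ j <= prodto A j.
Proof.
  intros HA Ai Au r Hr; destruct (Au r) as [k0 Hk0].
  apply (lower_bound_extend (prodto A) (fun j => r ^ j) k0 (prodto A k0 / r ^ k0)).
  - intros p; apply prodto_pos, HA.
  - intros p; now apply pow_lt.
  - apply Rdiv_lt_0_compat; [apply prodto_pos, HA|now apply pow_lt].
  - intros p Hp; induction Hp as [|p Hp IH].
    + apply Req_le; field; apply pow_nonzero; lra.
    + simpl.
      replace (prodto A k0 / r ^ k0 * (r * r ^ p)) with (prodto A k0 / r ^ k0 * r ^ p * r) by ring.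
      apply Rmult_le_compat; [|lra|exact IH|].
      * apply Rmult_le_pos; [|apply pow_le; lra].
        apply Rlt_le, Rdiv_lt_0_compat; [apply prodto_pos, HA|now apply pow_lt].
      * pose proof (incr_steps A Ai k0 p Hp); lra.
Qed.

(** Comparison with the integral of [x ^ (-1/2)]: if [A * sqrt tau] does not
    increase, then the boosted terms sum to at most
    [A p * sqrt (tau p)] times the telescoping sum of
    [2 * (sqrt (tau k) - sqrt (tau (k + 1)))]. *)
Lemma boosted_sum (A tau : nat -> R) :
  (forall p, 0 < A p) -> (forall p, 0 < tau p) -> (forall p, tau (S p) <= tau p) ->
  (forall p, A (S p) * sqrt (tau (S p)) <= A p * sqrt (tau p)) ->
  forall p n, sumto (fun k => A (p + k)%nat * (tau (p + k)%nat - tau (S (p + k)))) n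
              <= 2 * (A p * tau p).
Proof.
  intros HA Ht Ti Hd p n.
  assert (Hs : forall k, 0 < sqrt (tau k)) by (intros k; apply sqrt_lt_R0, Ht).
  assert (Hsd : forall k, sqrt (tau (S k)) <= sqrt (tau k)) by (intros k; apply sqrt_le_1_alt, Ti).
  assert (Hdd : forall k, A (p + k)%nat * sqrt (tau (p + k)%nat) <= A p * sqrt (tau p)).
  { induction k as [|k IH]; [rewrite Nat.add_0_r; lra|].
    rewrite Nat.add_succ_r; specialize (Hd (p + k)%nat); lra. }
  assert (H : sumto (fun k => A (p + k)%nat * (tau (p + k)%nat - tau (S (p + k)))) n
     <= 2 * (A p * sqrt (tau p)) * (sqrt (tau p) - sqrt (tau (p + n)%nat))).
  { induction n as [|n IH]; cbn [sumto]; [rewrite Nat.add_0_r; lra|].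
    rewrite Nat.add_succ_r.
    specialize (Hdd n); specialize (Hsd (p + n)%nat).
    pose proof (Hs (p + n)%nat) as Hs0; pose proof (Hs (S (p + n))) as Hs1.
    pose proof (HA (p + n)%nat) as HA0.
    replace (tau (p + n)%nat - tau (S (p + n))) with
      ((sqrt (tau (p + n)%nat) - sqrt (tau (S (p + n))))
       * (sqrt (tau (p + n)%nat) + sqrt (tau (S (p + n))))).
    2:{ rewrite <- (sqrt_sqrt (tau (p + n)%nat)) at 3 by (apply Rlt_le, Ht).
        rewrite <- (sqrt_sqrt (tau (S (p + n)))) at 3 by (apply Rlt_le, Ht).
        ring. }
    revert IH Hdd Hsd Hs0 Hs1 HA0.
    generalize (sqrt (tau (p + n)%nat)), (sqrt (tau (S (p + n)))), (A (p + n)%nat).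
    intros x y z IH Hdd Hsd Hx Hy Hz.
    assert (z * ((x - y) * (x + y)) <= 2 * (A p * sqrt (tau p)) * (x - y)); [|lra].
    apply Rle_trans with (2 * (z * x) * (x - y)); [|apply Rmult_le_compat_r; lra].
    replace (z * ((x - y) * (x + y))) with (z * (x + y) * (x - y)) by ring.
    apply Rmult_le_compat_r; [lra|]; nra. }
  eapply Rle_trans; [exact H|].
  rewrite <- (sqrt_sqrt (tau p)) at 3 by (apply Rlt_le, Ht).
  pose proof (Hs p); pose proof (Hs (p + n)%nat); pose proof (HA p).
  assert (0 < A p * sqrt (tau p)) by now apply Rmult_lt_0_compat.
  nra.
Qed.
(** The Beurling case is the Roumieu construction for the smaller weight
    [N j / (A 0 * ... * A (j - 1))]. The numbers [A k] tend to infinity, so every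
    [h] is reached; they grow so slowly that [A] stays below the decay rate [g]
    of the data and that the tail sums grow at most by a factor [2 * A p]. *)
Lemma Borel_image_B_Lseq (N : nat -> R) (s : nat) : (1 <= s)%nat ->
  LC N -> nonquasianalytic N -> Borel_image_B N (Lseq N s).
Proof.
  intros Hs [HN [H0 [_ [HL _]]]] Hq a Ha.
  pose proof (Lseq_pos N s Hs HN Hq) as HLp.
  assert (Hs1 : 1 <= INR s) by (apply (le_INR 1), Hs).
  pose (tau := fun k => tail_sum N (S k)).
  assert (Ht : forall k, 0 < tau k) by (intros k; now apply tail_sum_pos).
  assert (Ti : forall k, tau (S k) <= tau k) by (intros k; apply tail_sum_decr; auto).
  destruct (bounded_root_weight (fun p => Cmod (a p) / Lseq N s p))
    as [g [B [HB [Hg [Gi [Gu Gb]]]]]].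
  { intros p; apply Rdiv_le_0_compat; [apply Cmod_ge_0|apply HLp]. }
  { intros h Hh; destruct (Lambda_h_bound (Lseq N s) h a HLp Hh (Ha h Hh)) as [B [_ HB]].
    exists B; intros p; apply Rle_div_l; [apply HLp|]; specialize (HB p); lra. }
  destruct (throttle_spec g (fun k => sqrt (tau k))) as [HA [HAg [Ai [Ad Au]]]]; try assumption.
  { intros p; apply sqrt_lt_R0, Ht. }
  { intros p; apply sqrt_le_1_alt, Ti. }
  { intros e He; destruct (tail_sum_small N HN Hq (e * e)) as [n0 Hn0]; [nra|].
    exists n0; intros q Hqn; rewrite <- (sqrt_square e) by lra.
    apply sqrt_lt_1_alt; split; [apply Rlt_le, Ht|now apply Hn0]. }
  set (A := throttle g (fun k => sqrt (tau k))) in *.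
  pose (w := fun k => A k * inv_nu N k).
  pose proof (inv_nu_pos N HN) as Hi.
  assert (Hw : forall k, 0 < w k) by (intros k; now apply Rmult_lt_0_compat).
  assert (EW : forall j, prodto (fun k => / w k) j * prodto A j = N j).
  { intros j; rewrite <- (prodto_nu N HN H0 j); induction j as [|j IH]; cbn [prodto]; [ring|].
    rewrite <- IH; unfold w, inv_nu.
    pose proof (HA j); pose proof (nu_pos N HN (S j)); field; lra. }
  assert (At : forall p q, (p <= q)%nat -> A q * tau q <= A p * tau p).
  { intros p q Hpq; induction Hpq as [|q Hpq IH]; [lra|].
    eapply Rle_trans; [|exact IH].
    rewrite <- (sqrt_sqrt (tau (S q))), <- (sqrt_sqrt (tau q)), <- !Rmult_assoc by (apply Rlt_le, Ht).
    apply Rmult_le_compat; [|apply sqrt_pos|apply Ad|apply sqrt_le_1_alt, Ti].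
    apply Rmult_le_pos; [apply Rlt_le, HA|apply sqrt_pos]. }
  pose (t := fun p => 2 * (A (pred p) * tau (pred p))).
  destruct (borel_series_complex w t a (t 0%nat) B (4 * INR s)) as [f [K [H [HH [Sf [Sup [Vf Bf]]]]]]].
  - exact Hw.
  - intros p; split.
    + apply Rmult_lt_0_compat; [lra|now apply Rmult_lt_0_compat].
    + apply Rmult_le_compat_l; [lra|apply At; lia].
  - intros p n; apply Rle_trans with (2 * (A p * tau p)).
    + rewrite (sumto_ext _ (fun k => A (p + k)%nat * (tau (p + k)%nat - tau (S (p + k))))).
      * now apply boosted_sum.
      * intros k _; unfold w; f_equal; unfold tau.
        rewrite (tail_sum_step N (p + k) Hq); ring.
    + apply Rmult_le_compat_l; [lra|apply At; lia].
  - exact HB.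
  - lra.
  - intros p j Hj; specialize (Gb p); pose proof (Hg p) as Hgp.
    assert (Hgpp : 0 < g p ^ p) by now apply pow_lt.
    (* every factor is at most [g p], because [A <= g] and [g] is nondecreasing *)
    assert (HAp : A (pred p) ^ (p - j) * prodto A j <= g p ^ p).
    { replace (g p ^ p) with (g p ^ (p - j) * g p ^ j) by (rewrite <- pow_add; f_equal; lia).
      assert (HAk : forall k, (k <= p)%nat -> 0 <= A k <= g p).
      { intros k Hk; split; [apply Rlt_le, HA|].
        eapply Rle_trans; [apply HAg|now apply incr_steps]. }
      apply Rmult_le_compat.
      - apply pow_le, Rlt_le, HA.
      - apply Rlt_le, prodto_pos, HA.
      - apply pow_incr, HAk; lia.
      - clear - HAk Hj; induction j as [|j IH]; simpl; [lra|].
        rewrite Rmult_comm; apply Rmult_le_compat; [apply HAk; lia| |apply HAk; lia|apply IH; lia].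
        clear IH; induction j as [|j IH]; simpl; [lra|].
        apply Rmult_le_pos; [apply IH; lia|apply HAk; lia]. }
    assert (Ha1 : Cmod (a p) * g p ^ p <= B * Lseq N s p).
    { apply (Rmult_le_compat_r (Lseq N s p)) in Gb; [|apply Rlt_le, HLp].
      replace (Cmod (a p) / Lseq N s p * g p ^ p * Lseq N s p)
        with (Cmod (a p) * g p ^ p) in Gb by (field; specialize (HLp p); lra).
      exact Gb. }
    pose proof (Lseq_bound N s p j Hs HN H0 Hq Hj) as HLb.
    fold (tau (pred p)) in HLb.
    apply (Rmult_le_reg_r (g p ^ p)); [exact Hgpp|].
    eapply Rle_trans; [exact Ha1|].
    rewrite !Rmult_assoc; apply Rmult_le_compat_l; [exact HB|].
    eapply Rle_trans; [exact HLb|].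
    pose proof (HA (pred p)) as HAq; pose proof (Ht (pred p)) as Htq.
    set (m := (p - j)%nat) in *.
    pose proof (prodto_pos A j HA) as HPA.
    assert (HPw : 0 < prodto (fun k => / w k) j).
    { apply prodto_pos; intros k; apply Rinv_0_lt_compat, Hw. }
    pose proof (pos_INR p) as Hp0.
    assert (HX : 0 < ((INR p + 1) / tau (pred p)) ^ m) by (apply pow_lt, Rdiv_lt_0_compat; lra).
    replace (((INR p + 1) / t p) ^ m)
      with (((INR p + 1) / tau (pred p)) ^ m * ((/ 2) ^ m * (/ A (pred p)) ^ m)).
    2:{ rewrite <- !Rpow_mult_distr; f_equal; unfold t; field; lra. }
    set (X := ((INR p + 1) / tau (pred p)) ^ m) in *.
    replace (4 * INR s) with (2 * INR s * 2) by ring; rewrite (Rpow_mult_distr (2 * INR s) 2).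
    rewrite !Rmult_assoc; apply Rmult_le_compat_l; [apply pow_le; lra|].
    rewrite <- (EW j).
    set (Q := prodto (fun k => / w k) j) in *.
    assert (HAm : 0 < A (pred p) ^ m) by now apply pow_lt.
    apply Rle_trans with (X * Q * ((/ A (pred p)) ^ m * (A (pred p) ^ m * prodto A j))).
    + rewrite <- (Rmult_assoc ((/ A (pred p)) ^ m)), Rinv_pow_mult by exact HAq; lra.
    + assert (HAi : 0 < (/ A (pred p)) ^ m) by now apply pow_lt, Rinv_0_lt_compat.
      assert (H2 : 1 <= 2 ^ p * (/ 2) ^ m).
      { replace p with (j + m)%nat by (unfold m; lia).
        rewrite pow_add, Rmult_assoc, (Rmult_comm (2 ^ m)), Rinv_pow_mult, Rmult_1_r by lra.
        apply pow_R1_Rle; lra. }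
      replace (2 ^ p * (X * ((/ 2) ^ m * ((/ A (pred p)) ^ m * (Q * g p ^ p)))))
        with (X * Q * ((/ A (pred p)) ^ m * g p ^ p) * (2 ^ p * (/ 2) ^ m)) by ring.
      assert (HXQ : 0 < X * Q) by now apply Rmult_lt_0_compat.
      assert (HAG : 0 < (/ A (pred p)) ^ m * g p ^ p) by now apply Rmult_lt_0_compat.
      apply Rle_trans with (X * Q * ((/ A (pred p)) ^ m * g p ^ p)).
      * apply Rmult_le_compat_l; [lra|]; apply Rmult_le_compat_l; [lra|exact HAp].
      * assert (0 < X * Q * ((/ A (pred p)) ^ m * g p ^ p)) by now apply Rmult_lt_0_compat.
        nra.
  - exists f; split; [|exact Vf].
    intros h Hh; split; [exact Sf|split; [exact Sup|]].
    destruct (pow_le_prodto A HA Ai Au (H / h)) as [c [Hc Hcp]]; [now apply Rdiv_lt_0_compat|].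
    exists (Rabs K / c); intros p x.
    pose proof (pow_lt h p Hh) as Hhp; pose proof (HN p) as HNp.
    apply Rle_div_l; [now apply Rmult_lt_0_compat|].
    eapply Rle_trans; [apply Bf|].
    specialize (Hcp p); unfold Rdiv in Hcp.
    rewrite Rpow_mult_distr, pow_inv in Hcp.
    rewrite <- (EW p).
    set (Q := prodto (fun k => / w k) p).
    assert (HQ : 0 < Q) by (apply prodto_pos; intros k; apply Rinv_0_lt_compat, Hw).
    replace (Rabs K / c * (h ^ p * (Q * prodto A p)))
      with (Rabs K * Q * (/ c * h ^ p * prodto A p)) by (field; lra).
    apply Rle_trans with (Rabs K * Q * H ^ p).
    + pose proof (Rle_abs K); pose proof (pow_lt H p HH).
      assert (0 < H ^ p * Q) by now apply Rmult_lt_0_compat.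
      nra.
    + apply Rmult_le_compat_l; [apply Rmult_le_pos; [apply Rabs_pos|lra]|].
      apply (Rmult_le_compat_l (/ c * h ^ p)) in Hcp.
      * replace (/ c * h ^ p * (c * (H ^ p * / h ^ p))) with (H ^ p) in Hcp by (field; lra).
        exact Hcp.
      * apply Rmult_le_pos; [apply Rlt_le, Rinv_0_lt_compat, Hc|lra].
Qed.

Lemma Lambda_h_mono (M M' : nat -> R) (B h : R) (a : nat -> C) :
  positive_seq M -> positive_seq M' -> 1 <= B -> 0 < h ->
  (forall j, (1 <= j)%nat -> M j <= B ^ j * M' j) ->
  Lambda_h M h a -> Lambda_h M' (B * h) a.
Proof.
  intros HM HM' HB Hh HBj Ha.
  apply Lambda_h_bound in Ha as [D [HD Ha]]; [|exact HM|exact Hh].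
  assert (HDM : 0 <= D * (M 0%nat / M' 0%nat)).
  { apply Rmult_le_pos; [exact HD|apply Rlt_le, Rdiv_lt_0_compat; auto]. }
  exists (D + D * (M 0%nat / M' 0%nat)); intros p.
  assert (HBp : 0 < B ^ p) by (apply pow_lt; lra).
  pose proof (pow_lt h p Hh) as Hhp; pose proof (HM' p) as HMp.
  assert (HP : 0 < (B * h) ^ p * M' p).
  { rewrite Rpow_mult_distr; apply Rmult_lt_0_compat; [now apply Rmult_lt_0_compat|exact HMp]. }
  apply Rle_div_l; [exact HP|].
  eapply Rle_trans; [apply Ha|].
  rewrite Rmult_plus_distr_r.
  destruct p as [|p].
  - simpl in *.
    replace (D * (M 0%nat / M' 0%nat) * (1 * M' 0%nat)) with (D * (1 * M 0%nat)) by (field; lra).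
    assert (0 <= D * (1 * M' 0%nat)) by (apply Rmult_le_pos; lra); lra.
  - apply Rle_trans with (D * ((B * h) ^ S p * M' (S p))).
    + apply Rmult_le_compat_l; [exact HD|].
      rewrite Rpow_mult_distr, (Rmult_comm (B ^ S p)), Rmult_assoc.
      apply Rmult_le_compat_l; [lra|apply HBj; lia].
    + assert (0 <= D * (M 0%nat / M' 0%nat) * ((B * h) ^ S p * M' (S p)))
        by (apply Rmult_le_pos; lra); lra.
Qed.

Lemma Borel_image_R_mono (N M M' : nat -> R) :
  positive_seq M -> positive_seq M' -> preceq M M' ->
  Borel_image_R N M' -> Borel_image_R N M.
Proof.
  intros HM HM' HP HI a [h [Hh Ha]]; apply HI.
  apply preceq_iff in HP as [B [HB HBj]]; try assumption.
  exists (B * h); split; [nra|now apply Lambda_h_mono with M].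
Qed.

Lemma Borel_image_B_mono (N M M' : nat -> R) :
  positive_seq M -> positive_seq M' -> preceq M M' ->
  Borel_image_B N M' -> Borel_image_B N M.
Proof.
  intros HM HM' HP HI a Ha; apply HI; intros h Hh.
  apply preceq_iff in HP as [B [HB HBj]]; try assumption.
  assert (HhB : 0 < h / B) by (apply Rdiv_lt_0_compat; lra).
  replace h with (B * (h / B)) by (field; lra).
  apply Lambda_h_mono with M; auto.
Qed.
(** * Bounds forced by interpolation *)

Lemma exp_taylor_le_3 (n : nat) : sum_f_R0 (fun i => / INR (fact i)) n <= 3.
Proof.
  eapply Rle_trans; [|apply exp_le_3].
  eapply Rle_trans; [|apply (exp_ge_taylor 1 n); lra].
  apply sum_Rle; intros i _; rewrite pow1; lra.
Qed.

(** One step of Bang's argument. The step [x - a] is so short that Taylor's formula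
    at [a] loses at most the factor [exp 1 <= 3], less than the factor [4] that
    separates the bounds of consecutive levels [m]. *)
Lemma flat_propagation_step (v : nat -> R -> R) (K : nat -> R) (kappa a x : R) (k m : nat) :
  tower v -> (forall l, 0 < K l) -> 0 < kappa -> (k < m)%nat ->
  (forall i, (k + i <= m)%nat -> K (k + i)%nat <= K k * kappa ^ i) ->
  (forall i, (k + i < m)%nat -> Rabs (v (k + i)%nat a) <= (1 / 4) ^ (m - (k + i)) * K (k + i)%nat) ->
  (forall z, a < z < x -> Rabs (v m z) <= K m) ->
  a < x -> x - a <= / (4 * kappa) ->
  Rabs (v k x) <= 3 * (1 / 4) ^ (m - k) * K k.
Proof.
  intros Tv HK Hk Hkm HKk Ha Hz Hax Hd.
  set (n := (m - k - 1)%nat).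
  destruct (tower_taylor (fun i => v (k + i)%nat) n a x (tower_shift v k Tv) Hax) as [z [Hzz E]].
  rewrite Nat.add_0_r in E; rewrite E; clear E.
  set (d := x - a) in *.
  assert (Hd0 : 0 < d) by (unfold d; lra).
  assert (Hkd : kappa * d <= 1 / 4).
  { apply (Rmult_le_compat_l kappa) in Hd; [|lra].
    replace (kappa * / (4 * kappa)) with (1 / 4) in Hd by (field; lra); exact Hd. }
  set (Q := (1 / 4) ^ (m - k) * K k).
  assert (HQ : 0 < Q) by (apply Rmult_lt_0_compat; [apply pow_lt; lra|apply HK]).
  assert (T : forall i y, (k + i <= m)%nat ->
     Rabs y <= (1 / 4) ^ (m - (k + i)) * K (k + i)%nat ->
     Rabs (d ^ i / INR (fact i) * y) <= Q * / INR (fact i)).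
  { intros i y Hi Hy.
    pose proof (INR_fact_lt_0 i) as Hf; pose proof (Rinv_0_lt_compat _ Hf) as Hfi.
    rewrite Rabs_mult, Rabs_pos_eq by (apply Rdiv_le_0_compat; [apply pow_le; lra|exact Hf]).
    unfold Rdiv; rewrite (Rmult_comm (d ^ i)), Rmult_assoc, (Rmult_comm Q).
    apply Rmult_le_compat_l; [lra|].
    specialize (HKk i Hi).
    apply Rle_trans with (d ^ i * ((1 / 4) ^ (m - (k + i)) * (K k * kappa ^ i))).
    { apply Rmult_le_compat_l; [apply pow_le; lra|].
      eapply Rle_trans; [exact Hy|]; apply Rmult_le_compat_l; [apply pow_le; lra|exact HKk]. }
    replace (d ^ i * ((1 / 4) ^ (m - (k + i)) * (K k * kappa ^ i)))
      with ((1 / 4) ^ (m - (k + i)) * K k * (kappa * d) ^ i) by (rewrite Rpow_mult_distr; ring).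
    unfold Q; replace ((1 / 4) ^ (m - k)) with ((1 / 4) ^ (m - (k + i)) * (1 / 4) ^ i)
      by (rewrite <- pow_add; f_equal; lia).
    replace ((1 / 4) ^ (m - (k + i)) * (1 / 4) ^ i * K k)
      with ((1 / 4) ^ (m - (k + i)) * K k * (1 / 4) ^ i) by ring.
    apply Rmult_le_compat_l.
    - apply Rmult_le_pos; [apply pow_le; lra|apply Rlt_le, HK].
    - apply pow_incr; split; [apply Rmult_le_pos; lra|exact Hkd]. }
  apply Rle_trans with (Q * sum_f_R0 (fun i => / INR (fact i)) (S n)).
  - rewrite tech5, Rmult_plus_distr_l.
    eapply Rle_trans; [apply Rabs_triang|]; apply Rplus_le_compat.
    + eapply Rle_trans; [apply Rsum_abs|].
      rewrite scal_sum; apply sum_Rle; intros i Hi.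
      rewrite (Rmult_comm (/ INR (fact i))); apply T; [lia|apply Ha; lia].
    + apply T; [lia|].
      replace (k + S n)%nat with m by lia; rewrite Nat.sub_diag, pow_O, Rmult_1_l.
      now apply Hz.
  - pose proof (exp_taylor_le_3 (S n)); unfold Q in *; nra.
Qed.

(** A function whose derivatives of order below [q] vanish at [0] stays small on
    an interval whose length is the sum of the inverse quotients
    [/ (4 * kappa)]. Going from level [m] to level [m - 1] costs a factor [4] in
    the estimate and gains the length [/ (4 * kappa m)]. *)
Lemma flat_propagation (v : nat -> R -> R) (K kappa : nat -> R) (q : nat) (X : R) :
  tower v -> (forall l, 0 < K l) -> (forall l, 0 < kappa l) ->
  (forall k i m, (k + i <= m)%nat -> K (k + i)%nat <= K k * kappa m ^ i) ->
  (forall k, (k < q)%nat -> v k 0 = 0) ->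
  (forall k x, 0 <= x <= X -> Rabs (v k x) <= K k) ->
  forall n, (n < q)%nat -> forall x k, 0 <= x <= X ->
    x <= sumto (fun i => / (4 * kappa (q - i)%nat)) (S n) -> (k <= q - S n)%nat ->
    Rabs (v k x) <= 3 / 4 * (1 / 4) ^ (q - S n - k) * K k.
Proof.
  intros Tv HK Hkap HKk Hv0 HvK.
  pose (s := sumto (fun i => / (4 * kappa (q - i)%nat))).
  assert (Hs : forall n, 0 <= s n).
  { intros n; apply sumto_nonneg; intros i; apply Rlt_le, Rinv_0_lt_compat.
    specialize (Hkap (q - i)%nat); lra. }
  assert (STEP : forall n, (n < q)%nat ->
    (forall x k, 0 <= x <= X -> x <= s n -> (k <= q - n)%nat ->
       Rabs (v k x) <= (1 / 4) ^ (q - n - k) * K k) ->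
    forall x k, 0 <= x <= X -> x <= s (S n) -> (k <= q - S n)%nat ->
       Rabs (v k x) <= 3 / 4 * (1 / 4) ^ (q - S n - k) * K k).
  { intros n Hn W x k Hx Hxs Hk.
    replace (3 / 4 * (1 / 4) ^ (q - S n - k) * K k) with (3 * (1 / 4) ^ (q - n - k) * K k).
    2:{ replace (q - n - k)%nat with (S (q - S n - k)) by lia; simpl; field. }
    assert (HP : 0 < (1 / 4) ^ (q - n - k) * K k).
    { apply Rmult_lt_0_compat; [apply pow_lt; lra|apply HK]. }
    destruct (Rle_lt_dec x (s n)) as [Hxn|Hxn].
    - specialize (W x k Hx Hxn ltac:(lia)); lra.
    - specialize (Hs n).
      apply (flat_propagation_step v K (kappa (q - n)%nat) (s n) x k (q - n)); auto; try lia.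
      + intros i Hi; rewrite Nat.sub_add_distr.
        replace (q - n - k - i)%nat with (q - n - (k + i))%nat by lia.
        apply W; lra || lia.
      + intros z Hz; apply HvK; lra.
      + unfold s in Hxs |- *; simpl in Hxs; lra. }
  assert (W : forall n, (n <= q)%nat -> forall x k, 0 <= x <= X -> x <= s n -> (k <= q - n)%nat ->
       Rabs (v k x) <= (1 / 4) ^ (q - n - k) * K k).
  { induction n as [|n IH]; intros Hn x k Hx Hxs Hk.
    - destruct (Nat.eq_dec k q) as [->|Hkq].
      + replace (q - 0 - q)%nat with 0%nat by lia; rewrite pow_O, Rmult_1_l; now apply HvK.
      + simpl in Hxs; replace x with 0 by (unfold s in Hxs; simpl in Hxs; lra).
        rewrite Hv0, Rabs_R0 by lia.
        apply Rmult_le_pos; [apply pow_le; lra|apply Rlt_le, HK].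
    - eapply Rle_trans; [apply (STEP n); try assumption; try lia; apply IH; lia|].
      assert (0 < (1 / 4) ^ (q - S n - k) * K k).
      { apply Rmult_lt_0_compat; [apply pow_lt; lra|apply HK]. }
      lra. }
  intros n Hn; apply STEP; [exact Hn|]; apply W; lia.
Qed.

(** Weak bounds that always improve to strict ones cannot fail first at any
    point. *)
Lemma continuous_induction (P : nat -> R -> R) (b : nat -> R) (p : nat) (X : R) :
  (forall k x, continuous (P k) x) ->
  (forall k, (k <= p)%nat -> P k 0 <= b k) ->
  (forall x, 0 <= x <= X ->
     (forall y k, 0 <= y <= x -> (k <= p)%nat -> P k y <= b k) ->
     forall k, (k <= p)%nat -> P k x < b k) ->
  forall x k, 0 <= x <= X -> (k <= p)%nat -> P k x <= b k.
Proof.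
  intros HP H0 HS x1 k1 Hx1 Hk1.
  pose (E := fun x => 0 <= x <= x1 /\ forall y k, 0 <= y <= x -> (k <= p)%nat -> P k y <= b k).
  assert (E0 : E 0).
  { split; [lra|]; intros y k Hy Hk; replace y with 0 by lra; now apply H0. }
  destruct (completeness E) as [s [Hs1 Hs2]].
  { exists x1; intros y Hy; apply Hy. }
  { now exists 0. }
  assert (Hs : 0 <= s <= x1) by (split; [now apply Hs1|apply Hs2; intros y Hy; apply Hy]).
  assert (Hlt : forall y k, 0 <= y < s -> (k <= p)%nat -> P k y <= b k).
  { intros y k Hy Hk; apply Rnot_lt_le; intros Hn.
    assert (s <= y); [|lra].
    apply Hs2; intros z [Hz1 Hz2]; apply Rnot_lt_le; intros Hyz.
    specialize (Hz2 y k ltac:(lra) Hk); lra. }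
  assert (Es : E s).
  { split; [exact Hs|]; intros y k Hy Hk.
    destruct (Rlt_le_dec y s) as [Hys|Hys]; [apply Hlt; [lra|exact Hk]|].
    replace y with s by lra; apply Rnot_lt_le; intros Hn.
    destruct (Req_dec s 0) as [Hs0|Hs0]; [rewrite Hs0 in Hn; specialize (H0 k Hk); lra|].
    assert (HL : locally s (fun z => b k < P k z)).
    { apply (HP k s (fun t => b k < t)); now apply (open_gt (b k)). }
    destruct HL as [d Hd]; pose proof (cond_pos d) as Hdp.
    pose (z := Rmax 0 (s - d / 2)).
    assert (Hz : 0 <= z < s) by (unfold z; split; [apply Rmax_l|apply Rmax_lub_lt; lra]).
    assert (Hz' : s - d / 2 <= z) by apply Rmax_r.
    specialize (Hlt z k Hz Hk).
    assert (b k < P k z); [|lra].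
    apply Hd; change (Rabs (z - s) < d); rewrite Rabs_left; lra. }
  destruct (Rle_lt_or_eq_dec s x1 (proj2 Hs)) as [Hsx|Hsx].
  2:{ destruct Es as [_ Es]; apply Es; [lra|exact Hk1]. }
  exfalso.
  assert (HL : forall n, (n <= S p)%nat -> locally s (fun z => forall k, (k < n)%nat -> P k z <= b k)).
  { induction n as [|n IH]; intros Hn; [apply filter_forall; intros; lia|].
    assert (Hk : P n s < b n) by (apply HS; [lra|apply Es|lia]).
    assert (HLn : locally s (fun z => P n z < b n)).
    { apply (HP n s (fun t => t < b n)); now apply (open_lt (b n)). }
    specialize (IH ltac:(lia)).
    generalize (filter_and _ _ IH HLn); apply filter_imp; intros z [Hz1 Hz2] k Hkn.
    destruct (Nat.eq_dec k n) as [->|]; [lra|apply Hz1; lia]. }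
  destruct (HL (S p) (le_n _)) as [d Hd]; pose proof (cond_pos d) as Hdp.
  pose (z := Rmin x1 (s + d / 2)).
  assert (Hz : s < z <= x1) by (unfold z; split; [apply Rmin_glb_lt; lra|apply Rmin_l]).
  assert (Hz' : z <= s + d / 2) by apply Rmin_r.
  assert (z <= s); [|lra].
  apply Hs1; split; [lra|]; intros y k Hy Hk.
  destruct (Rle_lt_dec y s) as [Hys|Hys]; [apply Es; [lra|exact Hk]|].
  apply Hd; [|lia]; change (Rabs (y - s) < d); rewrite Rabs_pos_eq; lra.
Qed.

Definition taylor_poly (a : nat -> R) (p k : nat) (x : R) : R :=
  sumto (fun l => a l * mono l k x) (S p).

Lemma sumto_tower (F : nat -> nat -> R -> R) (n : nat) :
  (forall l, tower (F l)) -> tower (fun k x => sumto (fun l => F l k x) n).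
Proof.
  intros HF k x; induction n as [|n IH]; cbn [sumto].
  - apply (is_derive_const (V := R_NormedModule)).
  - apply (is_derive_plus (V := R_NormedModule)); [exact IH|apply HF].
Qed.

Lemma taylor_poly_tower (a : nat -> R) (p : nat) : tower (taylor_poly a p).
Proof.
  apply (sumto_tower (fun l k x => a l * mono l k x)).
  intros l k x; apply (is_derive_scal (mono l k)), mono_tower.
Qed.

Lemma taylor_poly_zero (a : nat -> R) (p k : nat) :
  taylor_poly a p k 0 = if le_lt_dec (S p) k then 0 else a k.
Proof.
  unfold taylor_poly; rewrite (sumto_single _ _ k).
  - destruct (le_lt_dec (S p) k); [reflexivity|].
    rewrite mono_zero; destruct (Nat.eq_dec k k); [ring|congruence].
  - intros l Hl; rewrite mono_zero; destruct (Nat.eq_dec k l); [congruence|ring].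
Qed.

Lemma taylor_poly_high (a : nat -> R) (p k : nat) (x : R) :
  (p < k)%nat -> taylor_poly a p k x = 0.
Proof.
  intros Hk; unfold taylor_poly.
  rewrite (sumto_ext _ (fun _ => 0 * 0)), sumto_scal; [ring|].
  intros l Hl; unfold mono; destruct (le_dec k l); [lia|ring].
Qed.

Lemma mono_nonneg (l k : nat) (x : R) : 0 <= x -> 0 <= mono l k x.
Proof.
  intros Hx; unfold mono; destruct (le_dec k l); [|lra].
  apply Rdiv_le_0_compat; [now apply pow_le|apply INR_fact_lt_0].
Qed.

Lemma taylor_poly_nonneg (a : nat -> R) (p k : nat) (x : R) :
  (forall l, 0 <= a l) -> 0 <= x -> 0 <= taylor_poly a p k x.
Proof.
  intros Ha Hx; apply sumto_nonneg; intros l.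
  apply Rmult_le_pos; [apply Ha|now apply mono_nonneg].
Qed.

Lemma taylor_poly_top (a : nat -> R) (p k : nat) (x : R) :
  (forall l, 0 <= a l) -> 0 <= x -> a p * mono p k x <= taylor_poly a p k x.
Proof.
  intros Ha Hx; unfold taylor_poly; cbn [sumto].
  assert (0 <= sumto (fun l => a l * mono l k x) p); [|lra].
  apply sumto_nonneg; intros l; apply Rmult_le_pos; [apply Ha|now apply mono_nonneg].
Qed.

Lemma taylor_poly_diag (a : nat -> R) (p : nat) (x : R) : taylor_poly a p p x = a p.
Proof.
  unfold taylor_poly; cbn [sumto].
  rewrite (sumto_ext _ (fun _ => 0 * 0)), sumto_scal.
  - unfold mono; destruct (le_dec p p) as [_|]; [|lia].
    rewrite Nat.sub_diag; simpl; field.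
  - intros l Hl; unfold mono; destruct (le_dec p l); [lia|ring].
Qed.

Lemma weight_ratio (N : nat -> R) : positive_seq N -> log_convex N ->
  forall k i m, (k + i <= m)%nat -> N (k + i)%nat <= N k * nu N m ^ i.
Proof.
  intros HN HL k i; induction i as [|i IH]; intros m Hm.
  - rewrite Nat.add_0_r; simpl; lra.
  - rewrite Nat.add_succ_r.
    replace (N (S (k + i))) with (nu N (S (k + i)) * N (k + i)%nat)
      by (simpl; field; specialize (HN (k + i)%nat); lra).
    rewrite <- tech_pow_Rmult, <- Rmult_assoc, (Rmult_comm (N k)), Rmult_assoc.
    apply Rmult_le_compat; [apply Rlt_le, nu_pos, HN|apply Rlt_le, HN| |apply IH; lia].
    apply nu_incr; [exact HN|exact HL|lia].
Qed.

(** As long as the Taylor polynomial [P] obeys the bound with constant [8], the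
    difference [F - P] obeys the bounds [9 * D k] and vanishes at [0] to order
    [q], so [flat_propagation] improves the constant [9] to [27 / 4]. Then [P]
    is at most [27 / 4 + 1 < 8] times [D k], which closes the continuous
    induction. *)
Lemma taylor_poly_bound (N : nat -> R) (F : nat -> R -> R) (C h X : R) (p q : nat) :
  positive_seq N -> log_convex N -> tower F -> 0 < C -> 0 < h ->
  (forall k x, Rabs (F k x) <= C * (h ^ k * N k)) ->
  (forall k, 0 <= F k 0) -> (1 <= p < q)%nat ->
  (forall k, (p < k < q)%nat -> F k 0 = 0) ->
  X <= sumto (fun i => / (4 * (h * nu N (q - i)%nat))) (S (q - p)) ->
  forall x k, 0 <= x <= X -> (k <= p)%nat ->
    taylor_poly (fun l => F l 0) p k x <= 8 * (C * (h ^ k * N k)).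
Proof.
  intros HN HL TF HC Hh HF HF0 Hpq Hgap HX.
  set (a := fun l => F l 0).
  pose (D := fun k => C * (h ^ k * N k)).
  assert (HD : forall k, 0 < D k).
  { intros k; apply Rmult_lt_0_compat; [exact HC|].
    apply Rmult_lt_0_compat; [now apply pow_lt|apply HN]. }
  pose proof (taylor_poly_tower a p) as TP.
  assert (HaD : forall k, a k <= D k).
  { intros k; eapply Rle_trans; [apply Rle_abs|apply HF]. }
  apply (continuous_induction (taylor_poly a p) (fun k => 8 * D k)).
  - intros k x; now apply tower_continuous.
  - intros k Hk; rewrite taylor_poly_zero; specialize (HaD k); specialize (HD k).
    destruct (le_lt_dec (S p) k); lra.
  - intros x Hx HB k Hk; pose proof (HD k) as HDk.
    destruct (Nat.eq_dec k p) as [->|Hkp].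
    { rewrite taylor_poly_diag; specialize (HaD p); lra. }
    assert (Tv : tower (fun k y => F k y - taylor_poly a p k y)).
    { intros i y; apply (is_derive_minus (V := R_NormedModule)); [apply TF|apply TP]. }
    assert (Hb := flat_propagation _ (fun k => 9 * D k) (fun l => h * nu N l) q x Tv).
    assert (Hv : Rabs (F k x - taylor_poly a p k x) <= 3 / 4 * (1 / 4) ^ (q - S (q - p) - k) * (9 * D k)).
    { apply Hb; try lia; try lra.
      - intros l; specialize (HD l); unfold D in *; lra.
      - intros l; apply Rmult_lt_0_compat; [exact Hh|apply nu_pos, HN].
      - intros i l m Hm; unfold D.
        rewrite pow_add, Rpow_mult_distr.
        pose proof (weight_ratio N HN HL i l m Hm).
        replace (9 * (C * (h ^ i * N i)) * (h ^ l * nu N m ^ l))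
          with (9 * (C * (h ^ i * h ^ l * (N i * nu N m ^ l)))) by ring.
        apply Rmult_le_compat_l; [lra|]; apply Rmult_le_compat_l; [lra|].
        apply Rmult_le_compat_l; [|assumption].
        apply Rmult_le_pos; apply pow_le; lra.
      - intros l Hl; rewrite taylor_poly_zero; unfold a.
        destruct (le_lt_dec (S p) l) as [Hpl|Hpl]; [rewrite Hgap by lia; ring|ring].
      - intros l y Hy.
        assert (HP8 : 0 <= taylor_poly a p l y <= 8 * D l).
        { split; [apply taylor_poly_nonneg; [exact HF0|lra]|].
          destruct (le_lt_dec l p) as [Hl|Hl]; [now apply HB|].
          rewrite taylor_poly_high by exact Hl; unfold D.
          assert (0 < h ^ l * N l) by (apply Rmult_lt_0_compat; [now apply pow_lt|apply HN]).
          nra. }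
        eapply Rle_trans; [apply Rabs_triang|]; rewrite Rabs_Ropp, (Rabs_pos_eq (taylor_poly a p l y)) by lra.
        specialize (HF l y); fold (D l) in HF; lra. }
    assert (H1 : (1 / 4) ^ (q - S (q - p) - k) <= 1).
    { apply Rle_trans with (1 ^ (q - S (q - p) - k)); [apply pow_incr; lra|rewrite pow1; lra]. }
    assert (Hv' : Rabs (F k x - taylor_poly a p k x) <= 3 / 4 * (9 * D k)).
    { eapply Rle_trans; [exact Hv|].
      assert (0 < (1 / 4) ^ (q - S (q - p) - k)) by (apply pow_lt; lra); nra. }
    specialize (HF k x); fold (D k) in HF.
    apply Rabs_le_between in HF; apply Rabs_le_between in Hv'; lra.
Qed.

(** All coefficients of the Taylor polynomial are nonnegative, so its bound at
    the point [X] holds for the leading term alone, and [X] is a fixed multiple of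
    the tail sum. The gap after [S r] is long enough to hold half of that sum. *)
Lemma lacunary_coefficient_bound (N : nat -> R) (F : nat -> R -> R) (C h : R) (s r n : nat) :
  (1 <= s)%nat -> positive_seq N -> log_convex N -> nonquasianalytic N ->
  tower F -> 0 < C -> 0 < h ->
  (forall k x, Rabs (F k x) <= C * (h ^ k * N k)) ->
  (forall k, 0 <= F k 0) -> (2 <= n)%nat ->
  (forall k, (S r < k < r + n)%nat -> F k 0 = 0) ->
  tail_sum N (S r) / 2 <= sumto (fun k => inv_nu N (r + k)) n ->
  F (S r) 0 <= 8 * C * (8 * h) ^ S r * Lseq N s (S r).
Proof.
  intros Hs HN HL Hq TF HC Hh HF HF0 Hn Hgap Htail.
  pose proof (tail_sum_pos N r HN Hq) as Ht.
  set (p := S r) in *; set (sg := tail_sum N p) in *.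
  set (X := sg / (8 * h)).
  assert (HX0 : 0 < X) by (apply Rdiv_lt_0_compat; lra).
  assert (HX : X <= sumto (fun i => / (4 * (h * nu N (r + n - i)%nat))) (S (r + n - p))).
  { replace (S (r + n - p)) with n by (unfold p; lia).
    rewrite (sumto_ext _ (fun i => / (4 * h) * inv_nu N (r + (n - S i)))).
    - rewrite sumto_scal, (sumto_rev (fun i => inv_nu N (r + i))).
      apply (Rmult_le_compat_l (/ (4 * h))) in Htail; [|apply Rlt_le, Rinv_0_lt_compat; lra].
      replace (/ (4 * h) * (sg / 2)) with X in Htail by (unfold X; field; lra).
      exact Htail.
    - intros i Hi; unfold inv_nu; replace (S (r + (n - S i))) with (r + n - i)%nat by lia.
      pose proof (nu_pos N HN (r + n - i)); field; lra. }
  assert (HP : forall j, (j < p)%nat ->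
     F p 0 <= 8 * C * (8 * h) ^ p * ((INR p / sg) ^ (p - j) * N j)).
  { intros j Hj.
    assert (HB := taylor_poly_bound N F C h X p (r + n) HN HL TF HC Hh HF HF0
                    ltac:(unfold p; lia) Hgap HX X j ltac:(lra) ltac:(lia)).
    pose proof (taylor_poly_top (fun l => F l 0) p j X HF0 ltac:(lra)) as HT.
    unfold mono in HT; destruct (le_dec j p) as [_|]; [|lia].
    set (m := (p - j)%nat) in *.
    pose proof (INR_fact_lt_0 m) as Hf; pose proof (pow_lt X m HX0) as HXm.
    assert (H1 : F p 0 * X ^ m <= 8 * (C * (h ^ j * N j)) * INR (fact m)).
    { apply Rle_div_l; [exact Hf|]; unfold Rdiv in *; lra. }
    assert (Hf1 : INR (fact m) <= INR p ^ m).
    { pose proof (fact_le_pow 0 m) as H; simpl in H; rewrite Rmult_1_r in H.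
      eapply Rle_trans; [exact H|]; apply pow_incr; split; [apply pos_INR|apply le_INR; lia]. }
    pose proof (HN j) as HNj; pose proof (pow_lt h j Hh) as Hhj.
    assert (H2 : F p 0 * X ^ m <= 8 * (C * (h ^ j * N j)) * INR p ^ m).
    { eapply Rle_trans; [exact H1|]; apply Rmult_le_compat_l; [|exact Hf1].
      apply Rmult_le_pos; [lra|]; apply Rmult_le_pos; [lra|]; apply Rmult_le_pos; lra. }
    apply (Rmult_le_reg_r (X ^ m)); [exact HXm|].
    eapply Rle_trans; [exact H2|].
    replace (8 * C * (8 * h) ^ p * ((INR p / sg) ^ m * N j) * X ^ m)
      with (8 * C * (8 * h) ^ p * N j * ((INR p / sg) * X) ^ m)
      by (rewrite (Rpow_mult_distr (INR p / sg) X); ring).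
    replace (INR p / sg * X) with (INR p * / (8 * h)) by (unfold X; field; lra).
    rewrite (Rpow_mult_distr (INR p)).
    replace ((8 * h) ^ p) with ((8 * h) ^ j * (8 * h) ^ m) by (rewrite <- pow_add; f_equal; lia).
    replace (8 * C * ((8 * h) ^ j * (8 * h) ^ m) * N j * (INR p ^ m * (/ (8 * h)) ^ m))
      with (8 * C * (8 * h) ^ j * N j * INR p ^ m * ((/ (8 * h)) ^ m * (8 * h) ^ m)) by ring.
    rewrite Rinv_pow_mult, Rmult_1_r by lra.
    apply Rmult_le_compat_r; [apply pow_le, pos_INR|].
    rewrite Rpow_mult_distr.
    assert (1 <= 8 ^ j) by (apply pow_R1_Rle; lra).
    assert (0 < C * (h ^ j * N j)) by (apply Rmult_lt_0_compat; [exact HC|now apply Rmult_lt_0_compat]).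
    replace (8 * C * (8 ^ j * h ^ j) * N j) with (8 * (C * (h ^ j * N j)) * 8 ^ j) by ring.
    nra. }
  assert (HA : 0 < 8 * C * (8 * h) ^ p) by (apply Rmult_lt_0_compat; [lra|apply pow_lt; lra]).
  assert (Hs1 : 1 <= INR s) by (apply (le_INR 1), Hs).
  assert (HLs : F p 0 / (8 * C * (8 * h) ^ p) <= Lseq N s p).
  { eapply Rle_trans; [|apply (Lseq_ge N s p (F p 0 / (8 * C * (8 * h) ^ p)))].
    - assert (1 <= INR s ^ p) by (apply pow_R1_Rle, Hs1).
      assert (0 <= F p 0 / (8 * C * (8 * h) ^ p)) by (apply Rdiv_le_0_compat; auto).
      nra.
    - unfold p; lia.
    - intros j Hj; apply Rle_div_l; [exact HA|].
      rewrite Rmult_comm; now apply HP. }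
  apply (Rle_div_l (F p 0) (Lseq N s p) _ HA) in HLs.
  rewrite Rmult_comm; exact HLs.
Qed.
Lemma not_preceq_frequently (M L : nat -> R) :
  positive_seq M -> positive_seq L -> ~ preceq M L ->
  forall B n0, 1 <= B -> exists p, (n0 <= p)%nat /\ B ^ S p * L (S p) < M (S p).
Proof.
  intros HM HL Hn B n0 HB; apply NNPP; intros HN; apply Hn.
  apply preceq_iff; try assumption.
  pose (f := fun k => M k / L k).
  assert (Hf : forall k, 0 <= f k) by (intros k; apply Rlt_le, Rdiv_lt_0_compat; auto).
  pose proof (sumto_nonneg f (S n0) Hf) as Hsum.
  exists (B + sumto f (S n0)); split; [lra|]; intros [|j] Hj; [lia|].
  pose proof (HL (S j)) as HLj.
  destruct (le_lt_dec n0 j) as [Hnj|Hnj].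
  - apply Rle_trans with (B ^ S j * L (S j)).
    + apply Rnot_lt_le; intros Hlt; apply HN; now exists j.
    + apply Rmult_le_compat_r; [lra|]; apply pow_incr; lra.
  - replace (M (S j)) with (f (S j) * L (S j)) by (unfold f; field; lra).
    apply Rmult_le_compat_r; [lra|].
    apply Rle_trans with (B + sumto f (S n0)).
    + pose proof (sumto_ge_term f (S n0) (S j) Hf ltac:(lia)); lra.
    + rewrite <- tech_pow_Rmult, <- (Rmult_1_r (B + sumto f (S n0))) at 1.
      apply Rmult_le_compat_l; [lra|]; apply pow_R1_Rle; lra.
Qed.

Lemma tail_sum_half (N : nat -> R) (r : nat) :
  positive_seq N -> nonquasianalytic N ->
  exists n0, forall n, (n0 <= n)%nat ->
    tail_sum N (S r) / 2 <= sumto (fun k => inv_nu N (r + k)) n.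
Proof.
  intros HN Hq; pose proof (tail_sum_pos N r HN Hq) as Ht.
  destruct (tail_sum_small N HN Hq (tail_sum N (S r) / 2)) as [n0 Hn0]; [lra|].
  exists n0; intros n Hn; specialize (Hn0 (r + n)%nat ltac:(lia)).
  rewrite (tail_sum_split N r n Hq) in *; lra.
Qed.

(** The indices [S (r i)] have gaps long enough for
    [lacunary_coefficient_bound], and [M] exceeds [L] at [p = S (r i)] by a
    factor whose [p]-th root is [(i + 1) ^ 2]. Half of this excess, [(i + 1) ^ p], is spent to
    put the coefficients into the Beurling class; the rest gives the
    contradiction. *)
Lemma lacunary_indices (N M L : nat -> R) :
  positive_seq N -> nonquasianalytic N -> positive_seq M -> positive_seq L -> ~ preceq M L ->
  exists r : nat -> nat,
    (forall i, (r i < r (S i))%nat) /\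
    (forall i, tail_sum N (S (r i)) / 2 <= sumto (fun k => inv_nu N (r i + k)) (S (r (S i)) - r i)) /\
    (forall i, ((INR i + 1) ^ 2) ^ S (r i) * L (S (r i)) < M (S (r i))).
Proof.
  intros HN Hq HM HL Hn.
  destruct (choice (fun (ir : nat * nat) r' =>
    (snd ir < r')%nat /\
    tail_sum N (S (snd ir)) / 2 <= sumto (fun k => inv_nu N (snd ir + k)) (S r' - snd ir) /\
    ((INR (fst ir) + 1) ^ 2) ^ S r' * L (S r') < M (S r'))) as [next Hnext].
  { intros [i r]; simpl fst; simpl snd.
    destruct (tail_sum_half N r HN Hq) as [n0 Hn0].
    destruct (not_preceq_frequently M L HM HL Hn ((INR i + 1) ^ 2) (S r + n0)) as [p [Hp HMp]].
    { pose proof (pos_INR i); nra. }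
    exists p; split; [lia|split; [apply Hn0; lia|exact HMp]]. }
  pose (r := fix r i := match i with O => next (0, 0)%nat | S i' => next (S i', r i') end).
  exists r; split; [|split].
  - intros i; apply (Hnext (S i, r i)).
  - intros i; apply (Hnext (S i, r i)).
  - intros [|i]; [apply (Hnext (0, 0)%nat)|apply (Hnext (S i, r i))].
Qed.

Lemma lacunary_sequence (M : nat -> R) (r : nat -> nat) :
  positive_seq M -> (forall i, (r i < r (S i))%nat) ->
  exists a : nat -> R, (forall k, 0 <= a k) /\
    (forall i, a (S (r i)) = (/ (INR i + 1)) ^ S (r i) * M (S (r i))) /\
    (forall k, (forall i, k <> S (r i)) -> a k = 0).
Proof.
  intros HM Hr.
  pose proof (strict_incr_steps r Hr) as Hmono.
  assert (Hinj : forall i j, r i = r j -> i = j).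
  { intros i j E; destruct (lt_eq_lt_dec i j) as [[Hl| ->]|Hl]; [|reflexivity|];
      apply Hmono in Hl; lia. }
  destruct (choice (fun k y => 0 <= y /\
     (forall i, k = S (r i) -> y = (/ (INR i + 1)) ^ k * M k) /\
     ((forall i, k <> S (r i)) -> y = 0))) as [a Ha].
  { intros k; destruct (classic (exists i, k = S (r i))) as [[i Hi]|Hk].
    - exists ((/ (INR i + 1)) ^ k * M k); split; [|split].
      + apply Rmult_le_pos; [|apply Rlt_le, HM].
        apply pow_le, Rlt_le, Rinv_0_lt_compat; pose proof (pos_INR i); lra.
      + intros j Hj; replace j with i by (apply Hinj; lia); reflexivity.
      + intros H; now destruct (H i).
    - exists 0; split; [lra|split; [|reflexivity]].
      intros i Hi; destruct Hk; now exists i. }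
  exists a; split; [intros k; apply Ha|split].
  - intros i; now apply Ha.
  - intros k Hk; now apply Ha.
Qed.

Lemma lacunary_Lambda_B (M : nat -> R) (r : nat -> nat) (a : nat -> R) :
  positive_seq M -> (forall k, 0 <= a k) ->
  (forall i, a (S (r i)) = (/ (INR i + 1)) ^ S (r i) * M (S (r i))) ->
  (forall k, (forall i, k <> S (r i)) -> a k = 0) ->
  Lambda_B M (fun k => RtoC (a k)).
Proof.
  intros HM Ha0 Ha Haz h Hh.
  pose (f := fun i => (/ ((INR i + 1) * h)) ^ S (r i)).
  assert (Hih : forall i, 0 < (INR i + 1) * h).
  { intros i; apply Rmult_lt_0_compat; [pose proof (pos_INR i); lra|exact Hh]. }
  assert (Hf : forall i, 0 <= f i).
  { intros i; apply pow_le, Rlt_le, Rinv_0_lt_compat, Hih. }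
  destruct (INR_unbounded (/ h)) as [i0 Hi0].
  pose proof (sumto_nonneg f i0 Hf) as Hsum.
  exists (1 + sumto f i0); intros k.
  rewrite Cmod_R, (Rabs_pos_eq (a k)) by apply Ha0.
  destruct (classic (exists i, k = S (r i))) as [[i ->]|Hk].
  - replace (a (S (r i)) / (h ^ S (r i) * M (S (r i)))) with (f i).
    2:{ rewrite Ha; unfold f.
        rewrite Rinv_mult, Rpow_mult_distr, (pow_inv h).
        pose proof (HM (S (r i))); pose proof (pow_lt h (S (r i)) Hh); field; lra. }
    destruct (le_lt_dec i0 i) as [Hi|Hi].
    + assert (f i <= 1); [|lra].
      unfold f; apply Rle_trans with (1 ^ S (r i)); [|rewrite pow1; lra].
      apply pow_incr; split.
      * apply Rlt_le, Rinv_0_lt_compat, Hih.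
      * apply le_INR in Hi.
        assert (H1 : / h * h <= (INR i + 1) * h) by (apply Rmult_le_compat_r; lra).
        rewrite Rinv_l in H1 by lra.
        rewrite <- Rinv_1; apply Rinv_le_contravar; lra.
    + pose proof (sumto_ge_term f i0 i Hf Hi); lra.
  - rewrite Haz by (intros i Hi; apply Hk; now exists i).
    unfold Rdiv; rewrite Rmult_0_l; lra.
Qed.

Lemma D_R_real_part (N : nat -> R) (f : R -> C) : positive_seq N -> D_R N f ->
  exists C h, 1 <= C /\ 0 < h /\ tower (Derive_n (fun t => Re (f t))) /\
    forall k x, Rabs (Derive_n (fun t => Re (f t)) k x) <= C * (h ^ k * N k).
Proof.
  intros HN [h [Hh [Sf [_ [B HB]]]]].
  exists (Rabs B + 1), h; pose proof (Rabs_pos B); split; [lra|split; [exact Hh|split]].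
  - apply tower_of_smooth; intros n x; apply Sf.
  - intros k x.
    assert (HP : 0 < h ^ k * N k) by (apply Rmult_lt_0_compat; [now apply pow_lt|apply HN]).
    specialize (HB k x); apply Rle_div_l in HB; [|exact HP].
    apply Rle_trans with (Cmod (CDerive_n f k x)).
    + eapply Rle_trans; [|apply Rmax_Cmod]; apply Rmax_l.
    + eapply Rle_trans; [exact HB|]; apply Rmult_le_compat_r; [lra|].
      pose proof (Rle_abs B); lra.
Qed.

(** Only the smaller class of data and the larger class of functions occur in the
    hypothesis, so it follows from either surjectivity property. A single
    lacunary sequence of data, interpolated by a single function, meets all the
    bad indices at once. *)
Lemma preceq_Lseq_of_interpolation (N M : nat -> R) (s : nat) : (1 <= s)%nat ->
  LC N -> nonquasianalytic N -> positive_seq M ->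
  (forall a, Lambda_B M a -> exists f, D_R N f /\ forall p, Borel f p = a p) ->
  preceq M (Lseq N s).
Proof.
  intros Hs [HN [_ [_ [HL _]]]] Hq HM Hint.
  pose proof (Lseq_pos N s Hs HN Hq) as HLp.
  apply NNPP; intros Hn.
  destruct (lacunary_indices N M (Lseq N s) HN Hq HM HLp Hn) as [r [Hr [Hrt HrM]]].
  destruct (lacunary_sequence M r HM Hr) as [a [Ha0 [Ha Haz]]].
  destruct (Hint _ (lacunary_Lambda_B M r a HM Ha0 Ha Haz)) as [f [Hf Hfa]].
  destruct (D_R_real_part N f HN Hf) as [C [h [HC [Hh [TF HF]]]]].
  set (F := Derive_n (fun t => Re (f t))) in *.
  assert (HFa : forall k, F k 0 = a k).
  { intros k; specialize (Hfa k); unfold Borel, CDerive_n in Hfa.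
    now injection Hfa. }
  (* [lacunary_coefficient_bound] gives the factor [8 * C * (8 * h) ^ p], which is
     at most [(64 * C * h) ^ p] *)
  destruct (INR_unbounded (64 * C * h)) as [i Hi].
  pose proof (strict_incr_steps r Hr) as Hmono.
  pose proof (Hr i) as Hri.
  assert (HB : F (S (r i)) 0 <= 8 * C * (8 * h) ^ S (r i) * Lseq N s (S (r i))).
  { apply (lacunary_coefficient_bound N F C h s (r i) (S (r (S i)) - r i)); auto; try lra; try lia.
    - intros k; rewrite HFa; apply Ha0.
    - intros k Hk; rewrite HFa; apply Haz; intros j Hj.
      destruct (lt_eq_lt_dec i j) as [[Hl| ->]|Hl]; [|lia|apply Hmono in Hl; lia].
      destruct (Nat.eq_dec j (S i)) as [->|]; [lia|].
      specialize (Hmono (S i) j ltac:(lia)); lia. }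
  rewrite HFa, Ha in HB.
  specialize (HrM i); specialize (HLp (S (r i))).
  set (p := S (r i)) in *.
  pose proof (pos_INR i) as Hi0.
  assert (Hip : 0 < (INR i + 1) ^ p) by (apply pow_lt; lra).
  assert (H1 : (INR i + 1) ^ p * Lseq N s p < 8 * C * (8 * h) ^ p * Lseq N s p).
  { eapply Rlt_le_trans; [|exact HB].
    apply (Rmult_lt_compat_l ((/ (INR i + 1)) ^ p)) in HrM.
    2:{ apply pow_lt, Rinv_0_lt_compat; lra. }
    eapply Rle_lt_trans; [|exact HrM].
    rewrite <- Rmult_assoc; apply Rmult_le_compat_r; [lra|].
    rewrite <- Rpow_mult_distr; apply Req_le; f_equal; field; lra. }
  apply Rmult_lt_reg_r in H1; [|exact HLp].
  assert (H2 : 8 * C * (8 * h) ^ p <= (8 * C) ^ p * (8 * h) ^ p).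
  { apply Rmult_le_compat_r; [apply pow_le; lra|].
    unfold p; rewrite <- tech_pow_Rmult, <- (Rmult_1_r (8 * C)) at 1.
    apply Rmult_le_compat_l; [lra|]; apply pow_R1_Rle; lra. }
  rewrite <- Rpow_mult_distr in H2.
  assert (H3 : (8 * C * (8 * h)) ^ p <= (INR i + 1) ^ p).
  { apply pow_incr; split; [|lra].
    apply Rmult_le_pos; lra. }
  lra.
Qed.

Lemma Lambda_B_Lambda_R (M : nat -> R) (a : nat -> C) : Lambda_B M a -> Lambda_R M a.
Proof. intros Ha; exists 1; split; [lra|apply Ha; lra]. Qed.

Lemma D_B_D_R (N : nat -> R) (f : R -> C) : D_B N f -> D_R N f.
Proof. intros Hf; exists 1; split; [lra|apply Hf; lra]. Qed.

Lemma preceq_Lseq_of_Borel_image_R (N M : nat -> R) (s : nat) : (1 <= s)%nat ->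
  LC N -> nonquasianalytic N -> positive_seq M -> Borel_image_R N M -> preceq M (Lseq N s).
Proof.
  intros Hs HN Hq HM HI; apply preceq_Lseq_of_interpolation; try assumption.
  intros a Ha; apply HI; now apply Lambda_B_Lambda_R.
Qed.

Lemma preceq_Lseq_of_Borel_image_B (N M : nat -> R) (s : nat) : (1 <= s)%nat ->
  LC N -> nonquasianalytic N -> positive_seq M -> Borel_image_B N M -> preceq M (Lseq N s).
Proof.
  intros Hs HN Hq HM HI; apply preceq_Lseq_of_interpolation; try assumption.
  intros a Ha; destruct (HI a Ha) as [f [Hf Hfa]]; exists f; split; [now apply D_B_D_R|exact Hfa].
Qed.

(** * The log-convex minorant *)

(** A pointwise supremum of log-convex sequences is log-convex. *)
Lemma ex_lc_minorant (M K0 : nat -> R) :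
  positive_seq K0 -> log_convex K0 -> (forall j, K0 j <= M j) ->
  exists K, is_lc_minorant M K.
Proof.
  intros HP HL HM.
  pose (E := fun j y => exists K, positive_seq K /\ log_convex K /\ (forall i, K i <= M i) /\ y = K j).
  assert (E0 : forall j, E j (K0 j)) by (intros j; now exists K0).
  destruct (choice (fun j m => is_lub (E j) m)) as [K HK].
  { intros j; destruct (completeness (E j)) as [m Hm].
    - exists (M j); intros y [K [_ [_ [H ->]]]]; apply H.
    - exists (K0 j); apply E0.
    - now exists m. }
  assert (Hub : forall K', positive_seq K' -> log_convex K' -> (forall j, K' j <= M j) ->
     forall j, K' j <= K j).
  { intros K' P' L' M' j; apply (proj1 (HK j)); now exists K'. }
  assert (KP : positive_seq K).
  { intros j; eapply Rlt_le_trans; [apply HP|now apply Hub]. }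
  exists K; split; [|exact Hub]; split; [exact KP|split].
  - intros j Hj; set (q := K (j - 1)%nat * K (j + 1)%nat).
    assert (Hq : 0 < q) by (apply Rmult_lt_0_compat; apply KP).
    assert (Hs : K j <= sqrt q).
    { apply (proj2 (HK j)); intros y [K' [P' [L' [M' ->]]]].
      rewrite <- (sqrt_pow2 (K' j)) by (apply Rlt_le, P').
      apply sqrt_le_1_alt; eapply Rle_trans; [now apply L'|].
      apply Rmult_le_compat; try (apply Rlt_le, P'); now apply Hub. }
    rewrite <- (pow2_sqrt q) by lra.
    apply pow_incr; split; [apply Rlt_le, KP|exact Hs].
  - intros j; apply (proj2 (HK j)); intros y [K' [_ [_ [M' ->]]]]; apply M'.
Qed.

Lemma log_convex_geometric_factorial (c A : R) :
  0 < c -> 0 < A -> log_convex (fun p => c * (A ^ p * INR (fact p))).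
Proof.
  intros Hc HA [|j] Hj; [lia|].
  replace (S j - 1)%nat with j by lia; replace (S j + 1)%nat with (S (S j)) by lia.
  rewrite !fact_simpl, !mult_INR, !S_INR; simpl pow.
  pose proof (INR_fact_lt_0 j); pose proof (pos_INR j); pose proof (pow_lt A j HA).
  set (f := INR (fact j)) in *; set (n := INR j) in *; set (Q := A ^ j) in *.
  assert (H4 : 0 < (c * A * Q * f) * (c * A * Q * f)).
  { assert (0 < c * A * Q * f) by (repeat apply Rmult_lt_0_compat; assumption).
    now apply Rmult_lt_0_compat. }
  replace (c * (A * Q * ((n + 1) * f)) * (c * (A * Q * ((n + 1) * f)) * 1))
    with ((c * A * Q * f) * (c * A * Q * f) * ((n + 1) * (n + 1))) by ring.
  replace (c * (Q * f) * (c * (A * (A * Q) * ((n + 1 + 1) * ((n + 1) * f)))))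
    with ((c * A * Q * f) * (c * A * Q * f) * ((n + 1 + 1) * (n + 1))) by ring.
  apply Rmult_le_compat_l; [lra|nra].
Qed.

(** Dividing by [K 0] and multiplying by a geometric sequence restores the
    normalization and stays within the equivalence class. *)
Lemma ex_Lseq_lc_tilde (N : nat -> R) (s : nat) : (1 <= s)%nat ->
  LC N -> nonquasianalytic N -> exists T, is_Lseq_lc_tilde N s T.
Proof.
  intros Hs [HN [H0 [H1 [HL Hlim]]]] Hq.
  pose proof (Lseq_pos N s Hs HN Hq) as HLp.
  pose proof (Lseq_outgrows_factorial N s Hs HN HL Hq) as HLo.
  assert (Hcp : forall c A, 0 < c -> 0 < A -> positive_seq (fun p => c * (A ^ p * INR (fact p)))).
  { intros c A Hc HA p; apply Rmult_lt_0_compat; [exact Hc|].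
    apply Rmult_lt_0_compat; [now apply pow_lt|apply INR_fact_lt_0]. }
  destruct (HLo 1 Rlt_0_1) as [c [Hc HcL]].
  destruct (ex_lc_minorant (Lseq N s) (fun p => c * (1 ^ p * INR (fact p)))) as [K HK].
  { apply Hcp; lra. }
  { apply log_convex_geometric_factorial; lra. }
  { exact HcL. }
  destruct HK as [[KP [KL KM]] KU].
  assert (Ko : outgrows_factorial K).
  { intros A HA; destruct (HLo A HA) as [cA [HcA HcAL]]; exists cA; split; [exact HcA|].
    apply (KU (fun p => cA * (A ^ p * INR (fact p)))); auto.
    now apply log_convex_geometric_factorial. }
  pose proof (KP 0%nat) as K0; pose proof (KP 1%nat) as K1.
  set (H := Rmax 1 (K 0%nat / K 1%nat)).
  assert (HH1 : 1 <= H) by apply Rmax_l.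
  pose (T := fun j => K j / K 0%nat * H ^ j).
  assert (TP : positive_seq T).
  { intros j; apply Rmult_lt_0_compat; [apply Rdiv_lt_0_compat; auto|apply pow_lt; lra]. }
  assert (To : outgrows_factorial T).
  { intros A HA; destruct (Ko A HA) as [cA [HcA HcAK]].
    exists (cA / K 0%nat); split; [now apply Rdiv_lt_0_compat|]; intros p.
    unfold T; replace (cA / K 0%nat * (A ^ p * INR (fact p)))
      with (cA * (A ^ p * INR (fact p)) / K 0%nat * 1) by (field; lra).
    apply Rmult_le_compat; [apply Rlt_le, Rdiv_lt_0_compat; [now apply Hcp|exact K0]|lra| |].
    - apply Rmult_le_compat_r; [apply Rlt_le, Rinv_0_lt_compat, K0|apply HcAK].
    - apply pow_R1_Rle, HH1. }
  assert (HI : 0 < / K 0%nat) by now apply Rinv_0_lt_compat.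
  assert (TK : preceq T K).
  { apply preceq_iff; try assumption.
    exists ((1 + / K 0%nat) * H); split; [nra|]; intros j Hj.
    unfold T; rewrite Rpow_mult_distr.
    replace ((1 + / K 0%nat) ^ j * H ^ j * K j) with ((1 + / K 0%nat) ^ j * (K j * H ^ j)) by ring.
    replace (K j / K 0%nat * H ^ j) with (/ K 0%nat * (K j * H ^ j)) by (field; lra).
    apply Rmult_le_compat_r.
    - apply Rmult_le_pos; [apply Rlt_le, KP|apply pow_le; lra].
    - destruct j as [|j]; [lia|]; rewrite <- tech_pow_Rmult.
      assert (1 <= (1 + / K 0%nat) ^ j) by (apply pow_R1_Rle; lra); nra. }
  assert (KT : preceq K T).
  { apply preceq_iff; try assumption.
    exists (1 + K 0%nat); split; [lra|]; intros j Hj.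
    assert (HHj : 1 <= H ^ j) by (apply pow_R1_Rle, HH1).
    assert (HKj : K 0%nat <= (1 + K 0%nat) ^ j).
    { destruct j as [|j]; [lia|]; rewrite <- tech_pow_Rmult.
      assert (1 <= (1 + K 0%nat) ^ j) by (apply pow_R1_Rle; lra); nra. }
    pose proof (KP j) as Kj; unfold T.
    replace ((1 + K 0%nat) ^ j * (K j / K 0%nat * H ^ j))
      with (K j * ((1 + K 0%nat) ^ j / K 0%nat * H ^ j)) by (field; lra).
    assert (H2 : 1 <= (1 + K 0%nat) ^ j / K 0%nat) by (apply (Rle_div_r 1 _ (K 0%nat)); lra).
    assert (1 <= (1 + K 0%nat) ^ j / K 0%nat * H ^ j) by nra.
    nra. }
  assert (KLs : preceq K (Lseq N s)).
  { apply preceq_iff; try assumption; exists 1; split; [lra|]; intros j _.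
    rewrite pow1, Rmult_1_l; apply KM. }
  exists T; split.
  - split; [split; [exact TP|split]|split; [exact TP|split; [|split; [|split]]]].
    + apply (outgrows_factorial_root_lim T (fun p => INR (fact p)) To).
      intros p; split; [apply INR_fact_lt_0|lra].
    + apply preceq_trans with K; try assumption.
      apply preceq_trans with (Lseq N s); try assumption.
      now apply Lseq_preceq.
    + unfold T; simpl; field; lra.
    + unfold T; rewrite pow_1.
      apply Rle_trans with (K 1%nat / K 0%nat * (K 0%nat / K 1%nat)).
      * apply Req_le; field; lra.
      * apply Rmult_le_compat_l; [apply Rlt_le; now apply Rdiv_lt_0_compat|apply Rmax_r].
    + intros j Hj; unfold T; specialize (KL j Hj).
      replace ((K j / K 0%nat * H ^ j) ^ 2)
        with ((/ K 0%nat) ^ 2 * H ^ (2 * j) * K j ^ 2)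
        by (rewrite !(Nat.mul_comm 2), pow_mult; field; lra).
      replace (K (j - 1)%nat / K 0%nat * H ^ (j - 1) * (K (j + 1)%nat / K 0%nat * H ^ (j + 1)))
        with ((/ K 0%nat) ^ 2 * H ^ (2 * j) * (K (j - 1)%nat * K (j + 1)%nat)).
      2:{ replace (2 * j)%nat with ((j - 1) + (j + 1))%nat by lia; rewrite pow_add; field; lra. }
      apply Rmult_le_compat_l; [|exact KL].
      apply Rmult_le_pos; apply pow_le; lra.
    + apply (is_lim_seq_ext (fun p => root p (T p / 1))).
      { intros p; f_equal; field. }
      apply (outgrows_factorial_root_lim T (fun _ => 1) To).
      intros p; split; [lra|]; apply (le_INR 1), lt_O_fact.
  - exists K; split; [split; [repeat split; assumption|exact KU]|split; assumption].
Qed.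

(** If [M j <= B ^ j * L j], then [M j / B ^ j] is a log-convex minorant of [L]. *)
Lemma preceq_lc_minorant (M L K : nat -> R) :
  LC M -> positive_seq L -> L 0%nat = 1 -> is_lc_minorant L K -> preceq M L -> preceq M K.
Proof.
  intros [MP [M0 [_ [ML _]]]] HLp HL0 [[KP _] KU] HML.
  apply preceq_iff in HML as [B [HB HBj]]; try assumption.
  apply preceq_iff; try assumption.
  exists B; split; [exact HB|]; intros j _.
  assert (HBp : forall i, 0 < B ^ i) by (intros i; apply pow_lt; lra).
  rewrite Rmult_comm; apply Rle_div_l; [apply HBp|].
  apply (KU (fun i => M i / B ^ i)).
  - intros i; apply Rdiv_lt_0_compat; auto.
  - intros i Hi; specialize (ML i Hi).
    replace ((M i / B ^ i) ^ 2) with (M i ^ 2 * / B ^ (2 * i)).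
    2:{ rewrite !(Nat.mul_comm 2), pow_mult; field; apply pow_nonzero; lra. }
    replace (M (i - 1)%nat / B ^ (i - 1) * (M (i + 1)%nat / B ^ (i + 1)))
      with (M (i - 1)%nat * M (i + 1)%nat * / B ^ (2 * i)).
    2:{ replace (2 * i)%nat with ((i - 1) + (i + 1))%nat by lia; rewrite pow_add.
        field; split; apply pow_nonzero; lra. }
    apply Rmult_le_compat_r; [apply Rlt_le, Rinv_0_lt_compat, HBp|exact ML].
  - intros [|i]; [simpl; rewrite M0, HL0; lra|].
    apply Rle_div_l; [apply HBp|]; rewrite Rmult_comm; apply HBj; lia.
Qed.

(** * Maximality *)

Theorem theorem3p4 (N : nat -> R) (HN : LC N) (Hnq : nonquasianalytic N) :
  (forall s : nat, (1 <= s)%nat ->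
     maximal (fun M => N_R N M /\ Borel_image_R N M) (Lseq N s) /\
     maximal (fun M => N_B N M /\ Borel_image_B N M) (Lseq N s)) /\
  (forall s : nat, (1 <= s)%nat ->
     (exists T, is_Lseq_lc_tilde N s T) /\
     (forall T, is_Lseq_lc_tilde N s T ->
        maximal (fun M => N_LC_R N M /\ Borel_image_R N M) T /\
        maximal (fun M => N_LC_B N M /\ Borel_image_B N M) T)).
Proof.
  split; intros s Hs.
  - pose proof (Lseq_N_B N s Hs HN Hnq) as HB.
    split; (split; [split|]).
    + now apply N_B_N_R.
    + now apply Borel_image_R_Lseq.
    + intros M [[MP _] HI]; now apply preceq_Lseq_of_Borel_image_R.
    + exact HB.
    + now apply Borel_image_B_Lseq.
    + intros M [[MP _] HI]; now apply preceq_Lseq_of_Borel_image_B.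
  - split; [now apply ex_Lseq_lc_tilde|].
    intros T [[TB TLC] [K [HK [TK KT]]]].
    pose proof (Lseq_pos N s Hs (proj1 HN) Hnq) as HLp.
    pose proof (proj1 TB) as TP; pose proof (proj1 (proj1 HK)) as KP.
    assert (TL : preceq T (Lseq N s)).
    { apply preceq_trans with K; try assumption.
      apply preceq_iff; try assumption; exists 1; split; [lra|]; intros j _.
      rewrite pow1, Rmult_1_l; apply HK. }
    assert (MT : forall M, LC M -> preceq M (Lseq N s) -> preceq M T).
    { intros M HM HML; apply preceq_trans with K; try assumption; [apply HM|].
      now apply preceq_lc_minorant with (Lseq N s). }
    split; (split; [split|]).
    + split; [now apply N_B_N_R|exact TLC].
    + apply Borel_image_R_mono with (Lseq N s); auto; now apply Borel_image_R_Lseq.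
    + intros M [[[MP _] MLC] HI]; apply MT; [exact MLC|].
      now apply preceq_Lseq_of_Borel_image_R.
    + split; assumption.
    + apply Borel_image_B_mono with (Lseq N s); auto; now apply Borel_image_B_Lseq.
    + intros M [[[MP _] MLC] HI]; apply MT; [exact MLC|].
      now apply preceq_Lseq_of_Borel_image_B.
Qed.
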